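(* Let $n\ge4$, let $\Phi$ be the root system of type $D_n$ with positive roots $\Phi^+=\{e_i\pm e_j\mid1\le i<j\le n\}$, and let $q$ be a prime power. Let $\alpha=e_1+e_i$ with $1<i\le n$, and let $a(\alpha)$, $\ell(\alpha)$, $k(\alpha)$, $S_\alpha$, $\overline{S}_\alpha$, $\overline{T}_\alpha$, $d_{1,i}$, $\mathrm{ob}(\alpha)$ and $\mathrm{kob}(\alpha)$ be as in the context. Then: (a) $S_\alpha/P(\ell(\alpha)\cup k(\alpha))\cong\overline{S}_\alpha/\overline{P(\ell(\alpha))}\cong\overline{T}_\alpha\times X_\alpha$, where $\overline{P(\ell(\alpha))}$ is the image of $P(\ell(\alpha))P(k(\alpha))$ in $\overline{S}_\alpha$. (b) $\overline{T}_\alpha\cong P(d_{1,i})/P(d_{1,i}\cap k(\alpha))\ltimes P(\mathrm{ob}(\alpha))/P(\mathrm{ob}(\alpha)\cap k(\alpha))$. (c) If $i<n$, then $\mathrm{kob}(\alpha)$ is a pattern that is normal in $d_{1,i}$ and $P(\mathrm{kob}(\alpha))$ centralizes $P(\mathrm{ob}(\alpha))/P(\mathrm{ob}(\alpha)\cap k(\alpha))$. (d) If $i=n$ then $P(\mathrm{ob}(\alpha))/P(\mathrm{ob}(\alpha)\cap k(\alpha))=\{1\}$. (e) If $i\in\{2,3\}$ and $i=n$ then $\overline{T}_\alpha=\{1\}$. (f) If $i\in\{2,3\}$ and $i<n$ then $\mathrm{kob}(\alpha)=d_{1,i}$, $k(\alpha)=n(\alpha)$ and $\overline{T}_\alpha\cong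 UD_{n-2}\times(UA_1)^{i-1}$. (g) If $i>3$ then $P(d_{1,i})/P(d_{1,i}\cap k(\alpha))$ is isomorphic to a quotient pattern group of $UD_{n-2}$. (h) If $i>3$ then $P(d_{1,i})/P(\mathrm{kob}(\alpha)\cup(k(\alpha)\cap d_{1,i}))\cong UA_{i-3}$.
   Context: $UD_n=UD_n(q)=\langle X_\gamma\mid\gamma\in\Phi^+\rangle$, where $X_\gamma$ are the root subgroups (isomorphic to $(\mathbb{F}_q,+)$) of the Chevalley group of type $D_n$ over $\mathbb{F}_q$; $UA_m=UA_m(q)$ is the analogous group of type $A_m$, i.e. the group of upper unitriangular $(m+1)\times(m+1)$ matrices over $\mathbb{F}_q$. For small ranks, $UD_2\cong UA_1\times UA_1$ and $UD_3\cong UA_3$. A set $S\subseteq\Phi^+$ is a closed pattern (or pattern) if $\beta,\gamma\in S$, $\beta+\gamma\in\Phi^+$ imply $\beta+\gamma\in S$; $P(S)=\langle X_\gamma\mid\gamma\in S\rangle$. For $N\subseteq S$ with $S$ a closed pattern, $N$ is normal in $S$ ($N\unlhd S$) if $\beta\in N,\gamma\in S,\beta+\gamma\in\Phi^+$ imply $\beta+\gamma\in N$; then $P(S)/P(N)$ is called a quotient pattern group of $P(S)$. For $\alpha\in\Phi^+$: $n(\alpha)$ is the smallest normal subset of $\Phi^+$ containing $\alpha$, with $\alpha$ removed; $k(\alpha)$ is the largest $N\unlhd\Phi^+$ with $\alpha\notin N$. For $\alpha=e_1+e_i$: $a(\alpha)=\{e_1-e_s\mid1<s<i\}\cup\{e_i\pm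 e_s\mid i<s\le n\}$, $\ell(\alpha)=\{e_s+e_i\mid1<s<i\}\cup\{e_1\pm e_s\mid i<s\le n\}$, $s(\alpha)=\Phi^+\setminus a(\alpha)$, $S_\alpha=P(s(\alpha))$, $\overline{S}_\alpha=S_\alpha/P(k(\alpha))$, $\overline{T}_\alpha=S_\alpha/P(\{\alpha\}\cup\ell(\alpha)\cup k(\alpha))$. Further $d_{1,i}=\{e_r\pm e_s\mid1<r<s\le n,\ r\ne i\ne s\}$, $\mathrm{ob}(\alpha)=\{e_r-e_i\mid1\le r<i\}$, and $\mathrm{kob}(\alpha)=d_{1,i}\setminus\{e_r-e_s\mid1<r<s<i\}$. *)

(* Defs.v *)
From HB Require Import structures.
From mathcomp Require Import all_boot all_order all_algebra all_fingroup all_solvable.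
From mathcomp Require Import zify.

Set Implicit Arguments.
Unset Strict Implicit.
Unset Printing Implicit Defensive.

Import GRing.Theory.
Local Open Scope ring_scope.

(* Coordinates are numbered from 1: [evec n k] is e_k in Z^n. *)
Definition evec (n k : nat) : 'rV[int]_n := \row_(j < n) (j.+1 == k)%:R.

(* The triple (r, s, true) encodes e_r + e_s and (r, s, false) encodes
   e_r - e_s, with 1 <= r < s <= n; the value 0 of 'I_n.+1 is never used. *)
Record posroot (n : nat) := PosRoot {
  root_data : 'I_n.+1 * 'I_n.+1 * bool;
  _ : (0 < root_data.1.1 < root_data.1.2)%N
}.
HB.instance Definition _ n := [isSub for @root_data n].
HB.instance Definition _ n := [Finite of posroot n by <:].

Section Roots.
Variable n : nat.
Implicit Types (b c d alpha : posroot n) (N S : {set posroot n}).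

Definition ri b : nat := (root_data b).1.1.
Definition rj b : nat := (root_data b).1.2.
Definition isplus b : bool := (root_data b).2.

Definition rvec b : 'rV[int]_n :=
  if isplus b then evec n (ri b) + evec n (rj b)
  else evec n (ri b) - evec n (rj b).

Definition pattern S : bool :=
  [forall b in S, forall c in S, forall d,
     (rvec b + rvec c == rvec d) ==> (d \in S)].

Definition pnormal N S : bool :=
  [&& pattern S, N \subset S &
   [forall b in N, forall c in S, forall d,
     (rvec b + rvec c == rvec d) ==> (d \in N)]].

(* An intersection of normal sets is normal, so this is the smallest normal
   set containing alpha. *)
Definition nclosure alpha : {set posroot n} :=
  \bigcap_(N : {set posroot n} | pnormal N setT && (alpha \in N)) N.

Definition nset alpha : {set posroot n} := nclosure alpha :\ alpha.

(* A union of normal sets is normal, so this is the largest normal set not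
   containing alpha: see [kset_normal], [notin_kset] and [kset_max]. *)
Definition kset alpha : {set posroot n} :=
  \bigcup_(N : {set posroot n} | pnormal N setT && (alpha \notin N)) N.

Lemma patternT : pattern setT.
Proof.
by apply/forall_inP=> b _; apply/forall_inP=> c _; apply/forallP=> d;
  rewrite inE implybT.
Qed.

Lemma pnormalTP N :
  reflect (forall b c d, b \in N -> rvec b + rvec c = rvec d -> d \in N)
          (pnormal N setT).
Proof.
rewrite /pnormal patternT subsetT /=.
apply: (iffP forall_inP) => [H b c d bN /eqP bcd | H b bN].
  by have /forall_inP/(_ c (in_setT c))/forallP/(_ d)/implyP/(_ bcd) := H b bN.
apply/forall_inP=> c _; apply/forallP=> d; apply/implyP=> /eqP.
exact: H bN.
Qed.

Lemma nclosure_normal alpha : pnormal (nclosure alpha) setT.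
Proof.
apply/pnormalTP=> b c d /bigcapP bN bcd.
apply/bigcapP=> N NP; have /andP[/pnormalTP nN _] := NP.
exact: nN (bN N NP) bcd.
Qed.

Lemma mem_nclosure alpha : alpha \in nclosure alpha.
Proof. by apply/bigcapP=> N /andP[]. Qed.

Lemma nclosure_min alpha N :
  pnormal N setT -> alpha \in N -> nclosure alpha \subset N.
Proof. by move=> nN aN; apply: bigcap_inf; rewrite nN. Qed.

Lemma kset_normal alpha : pnormal (kset alpha) setT.
Proof.
apply/pnormalTP=> b c d /bigcupP[N NP bN] bcd.
apply/bigcupP; exists N => //; have /andP[/pnormalTP nN _] := NP.
exact: nN bN bcd.
Qed.

Lemma notin_kset alpha : alpha \notin kset alpha.
Proof. by apply/bigcupP=> -[N /andP[_ /negP]]. Qed.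

Lemma kset_max alpha N :
  pnormal N setT -> alpha \notin N -> N \subset kset alpha.
Proof. by move=> nN aN; apply: bigcup_sup; rewrite nN. Qed.

(* The sets below depend on alpha = e_1 + e_i only through i. *)
Definition aset (i : nat) : {set posroot n} :=
  [set b | [&& ri b == 1, (1 < rj b < i) & ~~ isplus b]
        || ((ri b == i) && (i < rj b))]%N.

Definition lset (i : nat) : {set posroot n} :=
  [set b | [&& (1 < ri b < i), rj b == i & isplus b]
        || ((ri b == 1) && (i < rj b))]%N.

Definition sset (i : nat) : {set posroot n} := ~: aset i.

Definition dset (i : nat) : {set posroot n} :=
  [set b | [&& 1 < ri b, ri b != i & rj b != i]]%N.

Definition obset (i : nat) : {set posroot n} :=
  [set b | (rj b == i) && ~~ isplus b]%N.

Definition kobset (i : nat) : {set posroot n} :=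
  dset i :\: [set b | [&& 1 < ri b, rj b < i & ~~ isplus b]]%N.

End Roots.

(* Matrix unit with rows and columns numbered from 1. *)
Definition Emx (F : finFieldType) (m a b : nat) : 'M[F]_m :=
  \matrix_(p < m, q < m) ((p.+1 == a) && (q.+1 == b))%:R.

(* UD_n is realised in the natural 2n-dimensional representation of the
   Chevalley group (the split even orthogonal group), whose restriction to the
   maximal unipotent subgroup is faithful for every isogeny type and in every
   characteristic.  The weights e_1, ..., e_n, -e_n, ..., -e_1 number the basis
   vectors 1, ..., 2n, so that -e_k has position [opp_pos n k]; the root vectors
   are
     E_(r,s) - E_(-s,-r)  for e_r - e_s   and
     E_(r,-s) - E_(s,-r)  for e_r + e_s,
   and x_b(t) = exp (t * root vector) = 1 + t * root vector. *)
Definition opp_pos (n k : nat) : nat := ((n.*2).+1 - k)%N.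

Definition rootmx (n : nat) (F : finFieldType) (b : posroot n) :
    'M[F]_((n.*2).-1.+1) :=
  if isplus b then Emx F _ (ri b) (opp_pos n (rj b))
                   - Emx F _ (rj b) (opp_pos n (ri b))
  else Emx F _ (ri b) (rj b)
       - Emx F _ (opp_pos n (rj b)) (opp_pos n (ri b)).

Lemma Emx_mul0 (F : finFieldType) m a b c d :
  b != c -> Emx F m a b *m Emx F m c d = 0.
Proof.
move=> neq_bc; apply/matrixP=> p q; rewrite !mxE big1 // => k _; rewrite !mxE.
case: eqP => //= _; last by rewrite mul0r.
case: eqP => [->|_] /=; last by rewrite mul0r.
by rewrite (negPf neq_bc) mulr0.
Qed.

Section RootSubgroups.
Variables (n : nat) (F : finFieldType).
Implicit Types (b : posroot n) (S : {set posroot n}).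

Lemma root_bounds b : [/\ 0 < ri b, ri b < rj b & rj b <= n]%N.
Proof.
rewrite /ri /rj; case: b => [[[r s] e] /= rsP]; have [r_gt0 lt_rs] := andP rsP.
by split=> //; rewrite -ltnS ltn_ord.
Qed.

Lemma rootmx_sq0 b : rootmx F b *m rootmx F b = 0.
Proof.
have [h1 h2 h3] := root_bounds b.
rewrite /rootmx /opp_pos -addnn; case: ifP => _;
  rewrite mulmxBl !mulmxBr !Emx_mul0 ?subr0 //; apply/eqP; lia.
Qed.

Definition xmx b (t : F) : 'M[F]_((n.*2).-1.+1) := 1%:M + t *: rootmx F b.

Lemma xmxD b s t : xmx b (s + t) = xmx b s *m xmx b t.
Proof.
rewrite /xmx mulmxDl !mulmxDr !mulmx1 !mul1mx -scalemxAl -scalemxAr.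
by rewrite rootmx_sq0 !scaler0 addr0 scalerDl addrA addrAC.
Qed.

Lemma xmx0 b : xmx b 0 = 1%:M.
Proof. by rewrite /xmx scale0r addr0. Qed.

Lemma xmx_unit b t : xmx b t \is a GRing.unit.
Proof.
have xV: xmx b t *m xmx b (- t) = 1%:M by rewrite -xmxD subrr xmx0.
by have [] := mulmx1_unit xV.
Qed.

Definition xroot b (t : F) : {'GL_(n.*2)[F]} := FinRing.unit _ (xmx_unit b t).

Definition Xroot b : {set {'GL_(n.*2)[F]}} := [set xroot b t | t : F].

Lemma Xroot_group_set b : group_set (Xroot b).
Proof.
apply/group_setP; split=> [|_ _ /imsetP[s _ ->] /imsetP[t _ ->]].
  by apply/imsetP; exists 0 => //; apply: val_inj; rewrite /= xmx0.
by apply/imsetP; exists (s + t) => //; apply: val_inj; rewrite /= xmxD.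
Qed.

Canonical Xroot_group b := Group (Xroot_group_set b).

Definition P S : {set {'GL_(n.*2)[F]}} := <<\bigcup_(b in S) Xroot b>>%g.

Canonical P_group S := Eval hnf in [group of P S].

Definition Salpha (i : nat) : {set {'GL_(n.*2)[F]}} := P (sset n i).

Canonical Salpha_group i := Eval hnf in [group of Salpha i].

End RootSubgroups.

Definition UD (n : nat) (F : finFieldType) : {set {'GL_(n.*2)[F]}} :=
  P F [set: posroot n].

Canonical UD_group n F := Eval hnf in [group of UD n F].

Definition UA (m : nat) (F : finFieldType) : {set {'GL_(m.+1)[F]}} :=
  [set g : {'GL_(m.+1)[F]} | [forall p : 'I_m.+1, forall q : 'I_m.+1,
     (q <= p)%N ==> (GLval g p q == (p == q)%:R)]].

Lemma UA_group_set m F : group_set (UA m F).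
Proof.
apply/group_setP; split=> [|g h].
  rewrite inE; apply/forallP=> p; apply/forallP=> q.
  by apply/implyP=> _; rewrite GL_1E mxE.
have UAP k : (k \in UA m F) ->
    forall p q : 'I_m.+1, (q <= p)%N -> GLval k p q = (p == q)%:R.
  by rewrite inE => /forallP H p q le_qp; apply/eqP/(implyP (forallP (H p) q)).
move=> /UAP gU /UAP hU; rewrite inE.
apply/forallP=> p; apply/forallP=> q; apply/implyP=> le_qp; apply/eqP.
rewrite GL_MxE mxE (bigD1 p) //= gU // eqxx mul1r hU // big1 ?addr0 // => k neq_kp.
have [lt_kp | le_pk] := ltnP k p.
  by rewrite gU 1?ltnW // eq_sym (negPf neq_kp) mul0r.
rewrite hU ?(leq_trans le_qp) //; case: eqP => [eq_kq|]; last by rewrite mulr0.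
by case/eqP: neq_kp; apply: val_inj; apply/eqP; rewrite eqn_leq le_pk /= eq_kq le_qp.
Qed.

Canonical UA_group m F := Group (UA_group_set m F).

Definition Sbar (n : nat) (F : finFieldType) (i : nat) (alpha : posroot n) :
    {set coset_of (P F (kset alpha))} :=
  (Salpha n F i / P F (kset alpha))%g.

Definition Tbar (n : nat) (F : finFieldType) (i : nat) (alpha : posroot n) :
    {set coset_of (P F (alpha |: (lset n i :|: kset alpha)))} :=
  (Salpha n F i / P F (alpha |: (lset n i :|: kset alpha)))%g.

(* Main.v *)
Require Import Defs.
From mathcomp Require Import all_boot all_order all_algebra all_fingroup all_solvable.
From mathcomp Require Import zify ring.

(* The positive roots below alpha = e_1 + e_i are the e_r + e_s with i <= s and
   the e_r - e_s (with s <> n when i = n); this makes k(alpha) explicit and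
   reduces closure and normality of all the root sets to index arithmetic.

   Write M_b for the root vector of b.  Since [M_b, M_c] is a multiple of
   M_(b+c), or 0 when b + c is not a root, and M_c M_b M_c = 0, the conjugate
   of x_b(s) by x_c(t) lies in x_b(s) X_(b+c), so P(N) is normal in P(S) when N
   is normal in S.  Removing from a pattern S a root b of minimal height leaves
   a normal subset of S, and the matrix entry at the position of b is additive
   on P(S).  By induction |P(S)| = q^|S|, an element of P(S) is trivial as soon
   as its entries at the positions of S vanish, and P(S) and P(N) meet in
   P(S :&: N).  Parts (a) and (b) follow from the isomorphism theorems.

   The isomorphisms with UD_(n-2), UA_(i-3) and UA_1 restrict matrices to
   principal submatrices: delete the coordinates +-e_1 and +-e_i, keep the
   coordinates e_2, ..., e_(i-1), or keep the coordinates e_r and e_i. *)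

Set Implicit Arguments.
Unset Strict Implicit.
Unset Printing Implicit Defensive.

Import GRing.Theory.
Local Open Scope group_scope.

(** * Roots *)

(** Splits on an equality of indices only when arithmetic does not decide it, which keeps the case
    analysis on coincidences small. *)
Ltac nat_eq_step := match goal with
  |- context [@eq_op Datatypes_nat__canonical__eqtype_Equality ?x ?y] =>
    first [ have -> : (x == y) = false by lia
          | have -> : (x == y) = true by lia
          | case: (eqVneq x y) => [?|?]; [try subst y; try subst x|] ]
  end.

Section RootArithmetic.
Variable n : nat.
Implicit Types (b c d : posroot n) (N S : {set posroot n}).

Lemma posroot_eqE b c :
  (b == c) = [&& ri b == ri c, rj b == rj c & isplus b == isplus c].
Proof.
case: b c => [[[r s] e] p] [[[r' s'] e'] p'].
by rewrite -val_eqE /ri /rj /isplus /= !xpair_eqE andbA.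
Qed.

Lemma posroot_ex r s e :
  (0 < r < s)%N -> (s <= n)%N ->
  exists b, [/\ ri b = r, rj b = s & isplus b = e].
Proof.
move=> rs sn; have rn : (r < n.+1)%N by lia.
have sn' : (s < n.+1)%N by lia.
by exists (@PosRoot n (Ordinal rn, Ordinal sn', e) rs).
Qed.

(* [rdir b c d] means that b = e_r - e_t has the index t, cancelled in the sum
   d = b + c, as its second index. *)
Definition rdir b c d : bool :=
  ~~ isplus b &&
  [|| [&& rj b == ri c, ri d == ri b, rj d == rj c & isplus d == isplus c]
    , [&& isplus c, rj c == rj b, isplus d, ri d == ri b & rj d == ri c]
    | [&& isplus c, rj c == rj b, isplus d, ri d == ri c & rj d == ri b]].

Definition coord b k : int :=
  ((ri b == k)%:Z + (if isplus b then (rj b == k)%:Z else - (rj b == k)%:Z))%R.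

Lemma rvecE b (j : 'I_n) : rvec b ord0 j = coord b j.+1.
Proof.
rewrite /rvec /coord; case: ifP => _; rewrite !mxE;
  by rewrite ![j.+1 == _]eq_sym; do 2!case: eqP => _ //=.
Qed.

Lemma rdir_sum b c d : rdir b c d -> (rvec b + rvec c = rvec d)%R.
Proof.
rewrite /rdir /rvec => /andP[/negPf-> /or3P[]].
- case/and4P=> /eqP-> /eqP-> /eqP-> /eqP->.
  by case: ifP => _; rewrite addrA subrK.
- case/and5P=> -> /eqP-> -> /eqP-> /eqP->.
  by rewrite addrC addrACA subrr addr0 addrC.
case/and5P=> -> /eqP-> -> /eqP-> /eqP->.
by rewrite addrC addrACA subrr addr0.
Qed.

(** A sum of two positive roots is a root only if an index cancels against a minus sign. The vector
    equation is read at the six indices of [b], [c] and [d] only, which leaves finitely many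
    coincidences of indices to check. *)
Lemma rvec_sumP b c d :
  reflect (rvec b + rvec c = rvec d)%R (rdir b c d || rdir c b d).
Proof.
have [r0 rs sn] := root_bounds b; have [r0' rs' sn'] := root_bounds c.
have [r0'' rs'' sn''] := root_bounds d.
apply: (iffP idP) => [/orP[/rdir_sum|/rdir_sum] // | /rowP H];
  first by rewrite addrC.
have {}H k : (0 < k <= n)%N -> (coord b k + coord c k == coord d k)%R.
  move=> /andP[k0 kn]; have kn' : (k.-1 < n)%N by lia.
  by have := H (Ordinal kn'); rewrite mxE !rvecE /= prednK // => ->.
have Hrb : (0 < ri b <= n)%N by lia.
have Hsb : (0 < rj b <= n)%N by lia.
have Hrc : (0 < ri c <= n)%N by lia.
have Hsc : (0 < rj c <= n)%N by lia.
have Hrd : (0 < ri d <= n)%N by lia.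
have Hsd : (0 < rj d <= n)%N by lia.
move: {Hrb Hsb Hrc Hsc Hrd Hsd} (H _ Hrb) (H _ Hsb) (H _ Hrc) (H _ Hsc)
  (H _ Hrd) (H _ Hsd).
rewrite /rdir /coord {H}; move: r0 rs sn r0' rs' sn' r0'' rs'' sn''.
move: (ri b) (rj b) (ri c) (rj c) (ri d) (rj d)
  (isplus b) (isplus c) (isplus d)
  => r s r' s' r'' s'' p p' p'' r0 rs sn r0' rs' sn' r0'' rs'' sn''.
by case: p; case: p'; case: p''; rewrite /=;
  repeat (nat_eq_step; rewrite /= ?eqxx //=).
Qed.

Lemma rvec_inj : injective (@rvec n).
Proof.
move=> b c /rowP H; apply/eqP.
have [r0 rs sn] := root_bounds b; have [r0' rs' sn'] := root_bounds c.
have {}H k : (0 < k <= n)%N -> coord b k = coord c k.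
  move=> /andP[k0 kn]; have kn' : (k.-1 < n)%N by lia.
  by have := H (Ordinal kn'); rewrite !rvecE /= prednK.
have H1 : coord b (ri b) = coord c (ri b) by apply: H; lia.
have H2 : coord b (rj b) = coord c (rj b) by apply: H; lia.
have H3 : coord b (ri c) = coord c (ri c) by apply: H; lia.
rewrite posroot_eqE; move: H1 H2 H3; rewrite /coord {H}.
by case: (isplus b); case: (isplus c) => /=; lia.
Qed.

(** [rdir] in one direction suffices because [b] and [c] range over the same set. *)
Lemma patternP S :
  reflect (forall b c d, b \in S -> c \in S -> rdir b c d -> d \in S)
          (pattern S).
Proof.
apply: (iffP forall_inP) => [H b c d bS cS bcd | H b bS].
  have /forall_inP/(_ c cS)/forallP/(_ d)/implyP := H b bS; apply.
  by apply/eqP/rvec_sumP; rewrite bcd.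
apply/forall_inP=> c cS; apply/forallP=> d; apply/implyP=> /eqP/rvec_sumP.
by case/orP; apply: H.
Qed.

Lemma pnormalP N S :
  reflect [/\ pattern S, N \subset S &
    forall b c d, b \in N -> c \in S -> rdir b c d || rdir c b d -> d \in N]
    (pnormal N S).
Proof.
apply: (iffP and3P) => -[pS NS H]; split=> //.
  move=> b c d bN cS /rvec_sumP/eqP bcd.
  by have /forall_inP/(_ b bN)/forall_inP/(_ c cS)/forallP/(_ d)/implyP := H;
    apply.
apply/forall_inP=> b bN; apply/forall_inP=> c cS; apply/forallP=> d.
by apply/implyP=> /eqP/rvec_sumP; apply: H.
Qed.

Lemma pattern_normal N S : pnormal N S -> pattern N.
Proof.
case/pnormalP=> _ /subsetP NS H; apply/patternP=> b c d bN cN bcd.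
by apply: (H b c) => //; rewrite ?bcd ?NS.
Qed.

End RootArithmetic.

(** * The root sets of the statement and the explicit form of k(alpha) *)

Section RootSets.
Variables n i : nat.
Implicit Types (b c d : posroot n) (N S : {set posroot n}).

(* This is [kset alpha] for alpha = e_1 + e_i. *)
Definition kiset : {set posroot n} :=
  [set b | isplus b && (rj b < i)
        || [&& i == n, ~~ isplus b & rj b == n]]%N.

(** The positive roots of type A_(i-3) on the coordinates e_2, ..., e_(i-1). They are the roots that
    [kobset] removes from [dset], and they produce UA_(i-3) in part (h). *)
Definition midset : {set posroot n} :=
  [set b | [&& 1 < ri b, rj b < i & ~~ isplus b]]%N.

Hypothesis hi : (1 < i <= n)%N.

Ltac pattern_lia :=
  apply/patternP=> b c d;
  have [? ? ?] := root_bounds b; have [? ? ?] := root_bounds c;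
  have [? ? ?] := root_bounds d; rewrite !inE /rdir; lia.

Lemma pattern_sset : pattern (sset n i). Proof. pattern_lia. Qed.
Lemma pattern_dset : pattern (dset n i). Proof. pattern_lia. Qed.
Lemma pattern_obset : pattern (obset n i). Proof. pattern_lia. Qed.
Lemma pattern_midset : pattern midset. Proof. pattern_lia. Qed.
Lemma pattern_dset_obset : pattern (dset n i :|: obset n i).
Proof. pattern_lia. Qed.

Ltac pnormal_lia :=
  apply/pnormalP; split;
    [ done
    | apply/subsetP=> b; have [? ? ?] := root_bounds b;
      rewrite !inE; lia
    | move=> b c d; have [? ? ?] := root_bounds b;
      have [? ? ?] := root_bounds c;
      have [? ? ?] := root_bounds d; rewrite !inE /rdir; lia].

Lemma kiset_normal : pnormal kiset setT.
Proof. have pT := patternT n; pnormal_lia. Qed.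

Lemma mem_pnormalT N b c d :
  pnormal N setT -> b \in N -> rdir b c d || rdir c b d -> d \in N.
Proof. by case/pnormalP=> _ _ H bN; apply: (H b c d bN (in_setT c)). Qed.

Lemma lset_kiset_normal : pnormal (lset n i :|: kiset) (sset n i).
Proof. have pT := pattern_sset; pnormal_lia. Qed.

(** The smaller set is [sset n i] without alpha, see [sset_decomp]. Its normality yields the direct
    factor complementary to X_alpha in part (a). *)
Lemma sset_setD1_normal :
  pnormal (dset n i :|: obset n i :|: (lset n i :|: kiset)) (sset n i).
Proof. have pT := pattern_sset; pnormal_lia. Qed.

Lemma obset_normal : pnormal (obset n i) (dset n i :|: obset n i).
Proof. have pT := pattern_dset_obset; pnormal_lia. Qed.

Lemma dset_kiset_normal : pnormal (dset n i :&: kiset) (dset n i).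
Proof. have pT := pattern_dset; pnormal_lia. Qed.

Lemma obset_kiset_normal :
  pnormal (obset n i :&: kiset) (dset n i :|: obset n i).
Proof. have pT := pattern_dset_obset; pnormal_lia. Qed.

Lemma dset_obset_kiset_normal :
  pnormal ((dset n i :|: obset n i) :&: kiset) (dset n i :|: obset n i).
Proof. have pT := pattern_dset_obset; pnormal_lia. Qed.

Lemma obset_kiset : obset n i :&: kiset = if i == n then obset n i else set0.
Proof.
apply/setP=> b; have [? ? ?] := root_bounds b.
by case: eqP => [ein|nein]; rewrite !inE; lia.
Qed.

Lemma dset_obset : dset n i :&: obset n i = set0.
Proof. apply/setP=> b; rewrite !inE; lia. Qed.

(** Here c = e_r - e_i and b does not involve the index i, so the index cancelled in a sum could
    only be r, as the second index of b = e_s - e_r. Since r < i, such a b has been removed from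
    [kobset]. *)
Lemma kobset_obset_nosum b c d : (i < n)%N ->
  b \in kobset n i -> c \in obset n i -> ~~ (rdir b c d || rdir c b d).
Proof.
move=> ltin; have [? ? ?] := root_bounds b; have [? ? ?] := root_bounds c.
rewrite !inE => bk ck; apply/negP=> bcd.
have {bcd} : rj b = ri c /\ ~~ isplus b \/ rj c = ri b \/ rj c = rj b.
  by move: bcd; rewrite /rdir; lia.
lia.
Qed.

(** For i < n all roots of [kiset] have a plus sign, so those in [dset] belong to [kobset]. *)
Lemma dset_kiset_obset_nosum b c d : (i < n)%N ->
  b \in dset n i :&: kiset -> c \in obset n i -> ~~ (rdir b c d || rdir c b d).
Proof.
move=> ltin bdk; apply: kobset_obset_nosum => //.
by move: bdk; have [? ? ?] := root_bounds b; rewrite !inE; lia.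
Qed.

Lemma kobset_normal : (i < n)%N -> pnormal (kobset n i) (dset n i).
Proof. move=> ltin; have pT := pattern_dset; pnormal_lia. Qed.

Lemma kobset_kiset_normal :
  pnormal (kobset n i :|: (kiset :&: dset n i)) (dset n i).
Proof. have pT := pattern_dset; pnormal_lia. Qed.

Variable alpha : posroot n.
Hypotheses (ri_alpha : ri alpha = 1%N) (rj_alpha : rj alpha = i)
           (plus_alpha : isplus alpha).

Lemma eq_alpha b : (b == alpha) = [&& ri b == 1%N, rj b == i & isplus b].
Proof. by rewrite posroot_eqE ri_alpha rj_alpha plus_alpha eqb_id. Qed.

Ltac pnormal_alpha_lia :=
  apply/pnormalP; split;
    [ done
    | apply/subsetP=> b; have [? ? ?] := root_bounds b;
      rewrite !inE ?eq_alpha; lia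
    | move=> b c d; have [? ? ?] := root_bounds b;
      have [? ? ?] := root_bounds c;
      have [? ? ?] := root_bounds d; rewrite !inE ?eq_alpha /rdir; lia].

(** From any root outside [kiset] one climbs to alpha by adding positive roots, and a normal set is
    preserved along the way. *)
Lemma alpha_above N b : pnormal N setT -> b \in N -> b \notin kiset ->
  alpha \in N.
Proof.
move=> nN bN; rewrite inE => bk; have [b1 b2 b3] := root_bounds b.
have up := mem_pnormalT nN.
(* Adding e_1 - e_r replaces the first index r by 1; the second index and the sign are kept, so the
   root stays outside [kiset]. *)
wlog rb : b bk bN b1 b2 b3 / ri b = 1%N.
  have [rb|rb] := eqVneq (ri b) 1%N; first by move/(_ b); apply.
  case: (@posroot_ex n 1 (ri b) false) => [||c [c1 c2 c3]]; [lia|lia|].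
  case: (@posroot_ex n 1 (rj b) (isplus b)) => [||d [d1 d2 d3]]; [lia|lia|].
  move/(_ d); apply; rewrite ?inE ?d1 ?d2 ?d3 //; try lia.
  apply: (up b c d bN); rewrite /rdir c1 c2 c3 d1 d2 d3; lia.
(* The root e_1 + e_s with s > i reaches alpha by adding e_i - e_s. *)
have plus_case c : c \in N -> ri c = 1%N -> (i <= rj c)%N -> isplus c ->
  alpha \in N.
  move=> cN c1 c2 c3; have [_ _ c4] := root_bounds c.
  have [e2|/eqP ne2] := eqVneq (rj c) i.
    suff <- : c = alpha by []; apply/eqP; rewrite eq_alpha; lia.
  case: (@posroot_ex n i (rj c) false) => [||d [d1 d2 d3]]; [lia|lia|].
  by apply: (up c d alpha cN); rewrite /rdir ri_alpha rj_alpha; lia.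
have [pb|pb] := boolP (isplus b).
  by apply: (plus_case b bN rb) => //; lia.
(* For e_1 - e_s with s <> i, adding e_s + e_i gives alpha. For s = i, being outside [kiset] means i
   < n, and adding e_i + e_n leads to e_1 + e_n. *)
have [e2|/eqP ne2] := eqVneq (rj b) i; last first.
  case: (@posroot_ex n (minn (rj b) i) (maxn (rj b) i) true) =>
    [||c [c1 c2 c3]]; [lia|lia|].
  by apply: (up b c alpha bN); rewrite /rdir ri_alpha rj_alpha; lia.
case: (@posroot_ex n i n true) => [||c [c1 c2 c3]]; [lia|lia|].
case: (@posroot_ex n 1 n true) => [||d [d1 d2 d3]]; [lia|lia|].
apply: (plus_case d); [|lia..].
by apply: (up b c d bN); rewrite /rdir; lia.
Qed.

Lemma kset_alpha : kset alpha = kiset.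
Proof.
apply/eqP; rewrite eqEsubset andbC kset_max ?kiset_normal //=; last first.
  by rewrite inE; lia.
apply/subsetP=> b bk; apply: contraNT (notin_kset alpha) => bN.
exact: alpha_above (kset_normal alpha) bk bN.
Qed.

Lemma kset_alpha_nset : (i < n)%N -> (i <= 3)%N -> kset alpha = nset alpha.
Proof.
move=> ltin le3; rewrite kset_alpha; apply/eqP; rewrite eqEsubset.
apply/andP; split.
  apply/subsetP=> b bk; have [b1 b2 b3] := root_bounds b.
  move: bk; rewrite !inE ?eq_alpha => bk.
  have -> /= : ~~ [&& ri b == 1%N, rj b == i & isplus b] by lia.
  (* [kiset] is empty for i = 2 and consists of e_1 + e_2 for i = 3, where e_1 + e_2 = alpha + (e_2
     - e_3). *)
  case: (@posroot_ex n 2 3 false) => [||c [c1 c2 c3]]; [lia|lia|].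
  apply: (mem_pnormalT (c := c) (nclosure_normal alpha) (mem_nclosure alpha)).
  by rewrite /rdir; lia.
rewrite subDset; apply: nclosure_min; last by rewrite setU11.
have pT := patternT n; pnormal_alpha_lia.
Qed.

Lemma alpha_lset_kiset_normal :
  pnormal (alpha |: (lset n i :|: kiset)) (sset n i).
Proof. have pT := pattern_sset; pnormal_alpha_lia. Qed.

Lemma sset_decomp :
  sset n i = alpha |: (dset n i :|: obset n i :|: (lset n i :|: kiset)).
Proof.
apply/setP=> b; have [? ? ?] := root_bounds b; rewrite !inE eq_alpha; lia.
Qed.

End RootSets.

(** * Root subgroups and commutators *)

Section Commutators.
Variables (n : nat) (F : finFieldType).
Implicit Types (b c d : posroot n).

Local Notation E := (Emx F (n.*2).-1.+1).
Local Notation M := (@rootmx n F).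

Lemma Emx_mul (m a b c d : nat) : (0 < b <= m)%N ->
  (Emx F m a b *m Emx F m c d = (b == c)%:R *: Emx F m a d)%R.
Proof.
move=> hb; case: eqVneq => [<-|neq]; last by rewrite scale0r Emx_mul0.
rewrite scale1r; apply/matrixP=> p q; rewrite !mxE.
have bm : (b.-1 < m)%N by lia.
have bE : b.-1.+1 = b by lia.
rewrite (bigD1 (Ordinal bm)) //= big1 ?addr0 => [|k neq]; rewrite !mxE /= ?bE.
  by rewrite eqxx /= andbT -natrM mulnb.
have -> : (k.+1 == b) = false.
  by apply/negbTE; apply: contraNneq neq => kb; apply/eqP/val_inj;
    rewrite /= -kb.
by rewrite andbF mul0r.
Qed.

Lemma opp_pos_eq r s : (0 < r <= n)%N -> (0 < s <= n)%N ->
  (opp_pos n r == opp_pos n s) = (r == s).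
Proof. by rewrite /opp_pos; lia. Qed.

Lemma opp_pos_neq r s : (0 < r <= n)%N -> (0 < s <= n)%N ->
  (opp_pos n r == s) = false.
Proof. by rewrite /opp_pos; lia. Qed.

Lemma opp_pos_neqr r s : (0 < r <= n)%N -> (0 < s <= n)%N ->
  (s == opp_pos n r) = false.
Proof. by rewrite /opp_pos; lia. Qed.

Lemma opp_pos_bound r : (0 < r <= n)%N -> (0 < opp_pos n r <= (n.*2).-1.+1)%N.
Proof. by rewrite /opp_pos; lia. Qed.

(** The failure of every cancellation in [rdir], in both orders, stated without the sum [d]. The
    clause [ri c != ri b] sets apart the pair e_r - e_s, e_r + e_s, whose sum 2e_r is not a root. *)
Definition nosum b c : bool :=
  [&& ~~ (~~ isplus b && (rj b == ri c)),
      ~~ (~~ isplus c && (rj c == ri b)),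
      ~~ [&& ~~ isplus b, isplus c, rj c == rj b & ri c != ri b]
    & ~~ [&& ~~ isplus c, isplus b, rj c == rj b & ri c != ri b]].

Lemma root_sum_cases b c :
  [\/ exists d, rdir b c d, exists d, rdir c b d | nosum b c].
Proof.
have dir b' c' : ~~ isplus b' && (rj b' == ri c') ||
    [&& ~~ isplus b', isplus c', rj c' == rj b' & ri c' != ri b'] ->
  exists d, rdir b' c' d.
  have [? ? ?] := root_bounds b'; have [? ? ?] := root_bounds c'.
  rewrite /rdir; have [e|ne] := eqVneq (rj b') (ri c').
    rewrite andbT => H; case: (@posroot_ex n (ri b') (rj c') (isplus c')).
    - lia.
    - lia.
    by move=> d [e1 e2 e3]; exists d; rewrite e1 e2 e3; lia.
  rewrite andbF /= => H.
  case: (@posroot_ex n (minn (ri b') (ri c')) (maxn (ri b') (ri c')) true).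
  - lia.
  - lia.
  by move=> d [e1 e2 e3]; exists d; rewrite e1 e2 e3; lia.
have [h|h] := boolP (nosum b c); first by constructor 3.
have [h1|h1] := boolP (~~ isplus b && (rj b == ri c) ||
    [&& ~~ isplus b, isplus c, rj c == rj b & ri c != ri b]).
  by constructor 1; apply: dir.
constructor 2; apply: dir; move: h h1; rewrite /nosum; lia.
Qed.

Ltac Emx_expand :=
  rewrite ?(mulmxBl, mulmxBr) ?Emx_mul ?opp_pos_bound ?mulmxBl
     -?scalemxAl ?Emx_mul ?opp_pos_bound ?opp_pos_eq ?opp_pos_neq ?opp_pos_neqr;
   try lia.

Ltac Emx_ring :=
  rewrite /= ?mulr1n ?mulr0n ?(scale0r, scale1r, scaler0) //;
  by [ rewrite ?(subr0, sub0r, opprK)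
     | apply/matrixP=> p0 q0; rewrite ?mxE; ring].

Lemma rootmx_comm0 b c : nosum b c -> (M b *m M c = M c *m M b)%R.
Proof.
have [] := root_bounds b; have [] := root_bounds c; rewrite /nosum /rootmx.
move: (ri b) (rj b) (isplus b) (ri c) (rj c) (isplus c) => r s p r' s' p'.
move=> ? ? ? ? ? ?; case: p; case: p' => /= H; case: (eqVneq r r') => [?|?];
  try subst r'.
all: by Emx_expand; repeat nat_eq_step; Emx_ring.
Qed.

Lemma rootmx_comm b c d : rdir b c d ->
  exists e : F, (M b *m M c - M c *m M b = e *: M d)%R.
Proof.
have [] := root_bounds b; have [] := root_bounds c; have [] := root_bounds d.
rewrite /rdir /rootmx.
move: (ri b) (rj b) (isplus b) (ri c) (rj c) (isplus c) (ri d) (rj d) (isplus d)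
  => r s p r' s' p' r'' s'' p''.
move=> ? ? ? ? ? ? ? ? ? /andP[/negPf-> /or3P[]].
- case/and4P=> /eqP ? /eqP ? /eqP ? /eqP ?; subst; exists 1%R.
  by case: p'; Emx_expand; repeat nat_eq_step; Emx_ring.
(* The sign depends on which of the two remaining indices is smaller: the root vector of e_r + e_s
   changes sign when r and s are exchanged. *)
- case/and5P=> -> /eqP ? -> /eqP ? /eqP ?; subst; exists (-1)%R.
  by Emx_expand; repeat nat_eq_step; Emx_ring.
case/and5P=> -> /eqP ? -> /eqP ? /eqP ?; subst; exists 1%R.
all: by Emx_expand; repeat nat_eq_step; Emx_ring.
Qed.

(** A nonzero product would make 2c + b a difference of two weights among the +-e_k. Comparing sums
    of absolute values of coordinates, this forces b = -c, which is not positive. *)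
Lemma rootmx_sandwich b c : (M c *m M b *m M c = 0)%R.
Proof.
have [] := root_bounds b; have [] := root_bounds c; rewrite /rootmx.
move: (ri b) (rj b) (isplus b) (ri c) (rj c) (isplus c) => r s p r' s' p'.
move=> ? ? ? ? ? ?; case: p; case: p' => /=.
all: by Emx_expand; repeat nat_eq_step; Emx_ring.
Qed.

End Commutators.

Section PatternGroups.
Variables (n : nat) (F : finFieldType).
Implicit Types (b c d : posroot n) (S N T : {set posroot n}).

Local Notation M := (@rootmx n F).
Local Notation x_ := (@xroot n F).
Local Notation GL := {'GL_(n.*2)[F]}.

Lemma GLvalM (g h : GL) : GLval (g * h) = (GLval g *m GLval h)%R.
Proof. by []. Qed.

Lemma xrootD b s t : x_ b (s + t)%R = x_ b s * x_ b t.
Proof. by apply: val_inj; rewrite /= xmxD. Qed.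

Lemma xroot0 b : x_ b 0%R = 1.
Proof. by apply: val_inj; rewrite /= xmx0. Qed.

Lemma xrootV b t : (x_ b t)^-1 = x_ b (- t)%R.
Proof.
by apply: (mulgI (x_ b t)); rewrite mulgV -xrootD subrr; apply/esym/xroot0.
Qed.

Lemma xmx_conj b c s t (D : 'M[F]_((n.*2).-1.+1)) :
  (M b *m M c - M c *m M b = D)%R ->
  (xmx c (- t) *m xmx b s *m xmx c t = xmx b s + (s * t) *: D)%R.
Proof.
move=> <-; rewrite /xmx.
have CBC : (M c *m M b *m M c = 0)%R by apply: rootmx_sandwich.
have CC : (M c *m M c = 0)%R by apply: rootmx_sq0.
rewrite !(mulmxDl, mulmxDr, mul1mx, mulmx1) -?scalemxAl -?scalemxAr.
rewrite -?scalemxAl CBC CC !(scaler0, addr0) scaleNr !scalerBr !scalerA.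
by apply/matrixP=> p q; rewrite !mxE; ring.
Qed.

Lemma xroot_conj b c s t :
  x_ b s ^ x_ c t = x_ b s \/
  exists d r, (rdir b c d || rdir c b d) /\ x_ b s ^ x_ c t = x_ b s * x_ d r.
Proof.
have conjE D : (M b *m M c - M c *m M b = D)%R ->
    GLval (x_ b s ^ x_ c t) = (xmx b s + (s * t) *: D)%R.
  by move=> /(xmx_conj s t) <-; rewrite conjgE xrootV mulgA !GLvalM.
have sumE d e : (M b *m M c - M c *m M b = e *: M d)%R ->
    x_ b s ^ x_ c t = x_ b s * x_ d (s * t * e)%R.
  move=> /[dup] /conjE bcd BCD; apply: val_inj; rewrite [LHS]bcd.
  transitivity (xmx b s *m xmx d (s * t * e))%R; last by [].
  rewrite /xmx mulmxDr mulmx1 mulmxDl mul1mx -scalemxAr -scalemxAl !scalerA.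
  have -> : (s * t * e * s = s * t * s * e)%R by ring.
  rewrite -[((_ * e) *: (_ *m _))%R]scalerA.
  (* The extra term of the product x_b x_d vanishes, since e M_b M_d = M_b (M_b M_c - M_c M_b) is 0
     by M_b^2 = 0 and M_b M_c M_b = 0. *)
  suff -> : (e *: (M b *m M d) = 0)%R by rewrite scaler0 addr0.
  rewrite scalemxAr -BCD mulmxBr mulmxA rootmx_sq0 mul0mx mulmxA
    rootmx_sandwich.
  by rewrite subr0.
case: (root_sum_cases b c) => [[d bcd]|[d bcd]|bc0].
- right; have [e BCD] := rootmx_comm F bcd.
  by exists d, (s * t * e)%R; rewrite bcd; split=> //; apply: sumE.
- right; have [e BCD] := rootmx_comm F bcd.
  exists d, (s * t * (- e))%R; rewrite bcd orbT; split=> //; apply: sumE.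
  by rewrite scaleNr -BCD opprB.
left; apply: val_inj; rewrite [LHS](conjE 0%R) ?scaler0 ?addr0 //.
by rewrite rootmx_comm0 // subrr.
Qed.

Lemma sub_Xroot_P b S : b \in S -> Xroot F b \subset P F S.
Proof. by move=> bS; rewrite sub_gen // (bigcup_max b). Qed.

Lemma xroot_P b t S : b \in S -> x_ b t \in P F S.
Proof. by move=> bS; apply: (subsetP (sub_Xroot_P bS)); apply: imset_f. Qed.

Lemma P_subP S (G : {group GL}) :
  reflect (forall b t, b \in S -> x_ b t \in G) (P F S \subset G).
Proof.
rewrite gen_subG; apply: (iffP bigcupsP) => [H b t bS | H b bS].
  by apply: (subsetP (H b bS)); apply: imset_f.
by apply/subsetP=> _ /imsetP[t _ ->]; apply: H.
Qed.

Lemma P_mono S T : S \subset T -> P F S \subset P F T.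
Proof. by move=> /subsetP ST; apply/P_subP=> b t /ST; apply: xroot_P. Qed.

Lemma P_setU S T : P F (S :|: T) = P F S <*> P F T.
Proof.
apply/eqP; rewrite eqEsubset join_subG !P_mono ?subsetUl ?subsetUr // !andbT.
apply/P_subP=> b t /setUP[] bS; apply/mem_gen/setUP; [left|right];
  exact: xroot_P.
Qed.

Lemma P_set0 : P F (set0 : {set posroot n}) = 1.
Proof. by apply/trivgP/P_subP=> b t; rewrite inE. Qed.

Lemma P_set1 b : P F [set b] = Xroot F b.
Proof. by rewrite /P big_set1 genGid. Qed.

Lemma Xroot_norm c N :
  (forall b d, b \in N -> rdir b c d || rdir c b d -> d \in N) ->
  Xroot F c \subset 'N(P F N).
Proof.
move=> H; apply/subsetP=> _ /imsetP[t _ ->]; rewrite inE.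
rewrite -genJ gen_subG; apply/subsetP=> _ /imsetP[y + ->].
case/bigcupP=> b bN /imsetP[s _ ->].
case: (xroot_conj b c s t) => [->|[d [r [bcd ->]]]]; first exact: xroot_P.
by rewrite groupM ?xroot_P // (H b).
Qed.

Lemma P_norm S N :
  (forall b c d, b \in N -> c \in S -> rdir b c d || rdir c b d -> d \in N) ->
  P F S \subset 'N(P F N).
Proof.
move=> H; apply/(P_subP _ [group of 'N(P F N)])=> c t cS.
apply: (subsetP (Xroot_norm _)); last exact: imset_f.
by move=> b d bN; apply: H.
Qed.

Lemma P_normal S N : pnormal N S -> P F N <| P F S.
Proof.
by case/pnormalP=> _ NS H; rewrite /normal P_mono // P_norm.
Qed.

(** In a finite group the generated subgroup consists of products of generators, so no clause on
    inverses appears. *)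
Lemma P_ind S (Q : GL -> Prop) :
  Q 1 -> (forall x y, Q x -> Q y -> Q (x * y)) ->
  (forall b t, b \in S -> Q (x_ b t)) -> forall g, g \in P F S -> Q g.
Proof.
move=> Q1 QM QX g /gen_prodgP[m [c cS ->]]; apply: big_ind => // k _.
by have /bigcupP[b bS /imsetP[t _ ->]] := cS k; apply: QX.
Qed.

End PatternGroups.

(** * Orders and intersections of pattern groups *)

Section Factorization.
Variables (n : nat) (F : finFieldType).
Implicit Types (b c d : posroot n) (S N T : {set posroot n}).

Local Notation M := (@rootmx n F).
Local Notation x_ := (@xroot n F).
Local Notation GL := {'GL_(n.*2)[F]}.
Local Notation I := 'I_((n.*2).-1.+1).

(* The height of the root with root vector E_(p,q) is [depth q - depth p]: the
   middle basis vectors, of weights e_n and -e_n, have the same depth. *)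
Definition depth (p : nat) : nat := (p - (n <= p))%N.

Definition height b : nat :=
  if isplus b then ((n - ri b) + (n - rj b))%N else (rj b - ri b)%N.

(** Of the two nonzero entries of M_b, the position of the one with coefficient 1. Ordinals start at
    0, whence the predecessors. *)
Definition rootrow b : I := inord (ri b).-1.
Definition rootcol b : I :=
  inord (if isplus b then opp_pos n (rj b) else rj b).-1.

Lemma rootrowE b : rootrow b = (ri b).-1 :> nat.
Proof. have [? ? ?] := root_bounds b; rewrite inordK //; lia. Qed.

Lemma rootcolE b :
  rootcol b = (if isplus b then opp_pos n (rj b) else rj b).-1 :> nat.
Proof.
have [? ? ?] := root_bounds b; rewrite inordK // /opp_pos; case: ifP => _; lia.
Qed.

Lemma height_rdir b c d : rdir b c d -> height d = (height b + height c)%N.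
Proof.
have [? ? ?] := root_bounds b; have [? ? ?] := root_bounds c.
have [? ? ?] := root_bounds d.
rewrite /height /rdir; case: (isplus b) => //=.
by case: (isplus c); case: (isplus d); lia.
Qed.

Lemma height_gt0 b : (0 < height b)%N.
Proof.
have [? ? ?] := root_bounds b; rewrite /height; case: ifP => _; lia.
Qed.

Lemma depth_rootpos b : depth (rootcol b) = (depth (rootrow b) + height b)%N.
Proof.
have [? ? ?] := root_bounds b.
rewrite rootrowE rootcolE /depth /height /opp_pos; case: ifP => _; lia.
Qed.

(** The other matrix unit of M_b sits at (s,-r) or (-s,-r) with r < s, which is the chosen position
    of no root. *)
Lemma rootmx_entry b c : M b (rootrow c) (rootcol c) = (b == c)%:R%R.
Proof.
have [? ? ?] := root_bounds b; have [? ? ?] := root_bounds c.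
rewrite posroot_eqE /rootmx.
have subb (A B : bool) : ~~ B -> (A%:R - B%:R = A%:R :> F)%R.
  by move=> /negPf->; rewrite subr0.
case: (isplus b); rewrite !mxE rootrowE rootcolE /opp_pos subb.
- by congr (_%:R)%R; case: (isplus c) => /=; lia.
- by apply/negP=> /andP[/eqP]; case: (isplus c) => /=; lia.
- by congr (_%:R)%R; case: (isplus c) => /=; lia.
by apply/negP=> /andP[/eqP]; lia.
Qed.

Lemma natr_bool_sub0 (A B : bool) :
  ~~ A -> ~~ B -> (A%:R - B%:R = 0 :> F)%R.
Proof. by move=> /negPf-> /negPf->; rewrite subrr. Qed.

Lemma rootmx_depth0 b (p q : I) :
  depth q != (depth p + height b)%N -> M b p q = 0%R.
Proof.
have [? ? ?] := root_bounds b; have lp := ltn_ord p; have lq := ltn_ord q.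
rewrite /height /rootmx /depth /opp_pos; case: ifP => _ h; rewrite !mxE.
all: by apply: natr_bool_sub0; apply: contra h => /andP[/eqP e1 /eqP e2];
  apply/eqP; lia.
Qed.

(** A filtration by height: [g] agrees with the identity at every entry that raises the depth by
    less than [h]. *)
Definition deep h (g : GL) : Prop :=
  forall p q : I, (depth q < depth p + h)%N -> GLval g p q = (p == q)%:R%R.

(* An intermediate index k strictly between p and q would need depth at least
   [depth p + h] and at most [depth q - h], which is impossible. *)
Lemma deep_mulE h g g' (p q : I) : (0 < h)%N -> deep h g -> deep h g' ->
  (depth q <= depth p + h)%N ->
  GLval (g * g') p q = (GLval g p q + GLval g' p q - (p == q)%:R)%R.
Proof.
move=> h0 dg dg' le; rewrite GLvalM mxE (bigD1 p) //= dg ?eqxx ?mul1r;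
  last by lia.
have [->|neq] := eqVneq p q.
  rewrite big1 ?addr0 => [|k nk].
    by rewrite dg' ?dg ?eqxx ?addrK //; lia.
  have [lt|ge] := ltnP (depth k) (depth q + h).
    by rewrite dg // eq_sym (negPf nk) mul0r.
  by rewrite dg' ?(negPf nk) ?mulr0 //; lia.
rewrite subr0 (bigD1 q) 1?eq_sym //= [GLval g' q q]dg' ?eqxx ?mulr1;
  last by lia.
rewrite big1 ?addr0 1?addrC // => k /andP[nkp nkq].
have [lt|ge] := ltnP (depth k) (depth p + h).
  by rewrite dg // eq_sym (negPf nkp) mul0r.
by rewrite dg' ?(negPf nkq) ?mulr0 //; lia.
Qed.

Lemma xrootE b t (p q : I) :
  GLval (x_ b t) p q = ((p == q)%:R + t * M b p q)%R.
Proof. by rewrite /= !mxE. Qed.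

Lemma rootcol_neq b : rootrow b != rootcol b.
Proof.
rewrite -(inj_eq val_inj) /= rootrowE rootcolE /opp_pos.
by have [? ? ?] := root_bounds b; case: ifP => _; lia.
Qed.

Lemma xroot_entry b t c :
  GLval (x_ b t) (rootrow c) (rootcol c) = (t * (b == c)%:R)%R.
Proof. by rewrite xrootE rootmx_entry (negPf (rootcol_neq c)) add0r. Qed.

(** At level [h] the entries minus the identity are additive on [deep h], so it suffices to look at
    the generators, none of which belongs to [b]. *)
Lemma P_deep_entry0 S h b : (0 < h)%N -> (height b = h)%N -> b \notin S ->
  (forall c, c \in S -> (h <= height c)%N) ->
  forall g, g \in P F S -> deep h g /\ GLval g (rootrow b) (rootcol b) = 0%R.
Proof.
move=> h0 hb bS Sh; have neq := rootcol_neq b.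
apply: P_ind => [|g g' [dg g0] [dg' g0']|c t cS].
- split=> [p q _|]; first by rewrite GL_1E mxE.
  by rewrite GL_1E mxE (negPf neq).
- split=> [p q lt|].
    by rewrite (deep_mulE h0 dg dg') 1?ltnW // dg // dg' // addrK.
  rewrite (deep_mulE h0 dg dg'); last by rewrite depth_rootpos hb.
  by rewrite g0 g0' (negPf neq) addr0 subr0.
split=> [p q lt|].
  rewrite xrootE rootmx_depth0 ?mulr0 ?addr0 //.
  by have := Sh c cS; lia.
rewrite xroot_entry; case: eqP => [cb|]; last by rewrite mulr0.
by rewrite -cb cS in bS.
Qed.

(** Heights are positive and add up, so a root of minimal height in [S] is not a sum of two roots of
    [S]. *)
Lemma pattern_minD1 S : pattern S -> S != set0 ->
  exists b, [/\ b \in S, pnormal (S :\ b) S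
              & forall c, c \in S -> (height b <= height c)%N].
Proof.
move=> /[dup] pS /patternP pS' /set0Pn[b0 b0S].
case: (arg_minnP height b0S) => b bS minb; exists b; split=> //.
apply/pnormalP; split; rewrite ?subD1set // => c d e /setD1P[_ cS] dS sum.
have /(_ e) He : forall e, rdir c d e || rdir d c e -> e \in S.
  by move=> e' /orP[]; apply: pS'.
rewrite !inE He // andbT; apply: contraTneq sum => ->.
have := minb c cS; have := height_gt0 c; have := height_gt0 d;
  have := minb d dS.
by move=> ? ? ? ?; apply/norP; split; apply/negP=> /height_rdir; lia.
Qed.

Lemma P_D1 S b : b \in S -> pnormal (S :\ b) S ->
  P F S = P F (S :\ b) * Xroot F b.
Proof.
move=> bS nS; rewrite -{1}(setD1K bS) setUC P_setU P_set1 norm_joinEr //.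
apply: subset_trans (normal_norm (P_normal F nS)).
exact: sub_Xroot_P.
Qed.

Lemma P_D1_entry S b g : (forall c, c \in S -> (height b <= height c)%N) ->
  g \in P F (S :\ b) -> GLval g (rootrow b) (rootcol b) = 0%R.
Proof.
move=> minb gP; apply: (proj2 (P_deep_entry0 _ (erefl _) _ _ gP)).
- exact: height_gt0.
- by rewrite !inE eqxx.
by move=> c /setD1P[_]; apply: minb.
Qed.

Lemma P_D1_mul_entry S b g t : b \in S ->
  (forall c, c \in S -> (height b <= height c)%N) -> g \in P F (S :\ b) ->
  GLval (g * x_ b t) (rootrow b) (rootcol b) = t.
Proof.
move=> bS minb gP.
have dS c : c \in S :\ b -> (height b <= height c)%N.
  by case/setD1P=> _; apply: minb.
have bSb : b \notin S :\ b by rewrite !inE eqxx.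
have [dg g0] := P_deep_entry0 (height_gt0 b) (erefl _) bSb dS gP.
have dx : deep (height b) (x_ b t).
  move=> p q lt; rewrite xrootE rootmx_depth0 ?mulr0 ?addr0 //; lia.
rewrite (deep_mulE (height_gt0 b) dg dx) ?depth_rootpos //.
by rewrite g0 xroot_entry eqxx mulr1 (negPf (rootcol_neq b)) add0r subr0.
Qed.

Lemma P_entries0 S g : pattern S -> g \in P F S ->
  (forall b, b \in S -> GLval g (rootrow b) (rootcol b) = 0%R) -> g = 1.
Proof.
have [m] := ubnP #|S|; elim: m S g => // m IH S g;
  rewrite ltnS => leSm pS gS g0.
have [S0|Sn0] := eqVneq S set0.
  by move: gS; rewrite S0 P_set0 => /set1P.
have [b [bS nS minb]] := pattern_minD1 pS Sn0.
have := g0 b bS; move: gS; rewrite (P_D1 bS nS) =>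
  /mulsgP[g' _ g'S /imsetP[t _ ->] def_g].
(* The entry at the position of [b] recovers the parameter of the last factor; it is 0, so [g]
   already lies in P(S :\ b). *)
rewrite def_g (P_D1_mul_entry t bS minb g'S) => t0.
have gS' : g \in P F (S :\ b) by rewrite def_g t0 xroot0 mulg1.
rewrite -def_g; apply: (IH (S :\ b) g) => //.
- by move: leSm; rewrite (cardsD1 b) bS.
- exact: pattern_normal nS.
by move=> c /setD1P[_]; apply: g0.
Qed.

Lemma xroot_inj b : injective (x_ b).
Proof.
by move=> s t /(congr1 (fun g => GLval g (rootrow b) (rootcol b)));
  rewrite !xroot_entry eqxx !mulr1.
Qed.

Lemma card_Xroot b : #|Xroot F b| = #|F|.
Proof. by rewrite card_imset //; apply: xroot_inj. Qed.

Lemma card_P S : pattern S -> #|P F S| = (#|F| ^ #|S|)%N.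
Proof.
have [m] := ubnP #|S|; elim: m S => // m IH S; rewrite ltnS => leSm pS.
have [->|Sn0] := eqVneq S set0; first by rewrite P_set0 cards0 cards1.
have [b [bS nS minb]] := pattern_minD1 pS Sn0.
rewrite (P_D1 bS nS) TI_cardMg; last first.
  apply/trivgP/subsetP=> g /setIP[gS /imsetP[t _ gt]].
  have := P_D1_entry minb gS; rewrite gt xroot_entry eqxx mulr1 => ->.
  by rewrite xroot0 set11.
rewrite card_Xroot IH ?(cardsD1 b S) ?bS ?expnS 1?mulnC //.
- by move: leSm; rewrite (cardsD1 b) bS.
exact: pattern_normal nS.
Qed.

Lemma P_mul S N : (forall b c d, b \in N -> c \in S ->
  rdir b c d || rdir c b d -> d \in N) ->
  P F S * P F N = P F (S :|: N).
Proof. by move=> H; rewrite P_setU norm_joinEl // P_norm. Qed.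

(** One inclusion is clear and orders settle the rest: P(S)P(T) = P(S :|: T), so the product formula
    gives the intersection the order q^(|S| + |T| - |S :|: T|). *)
Lemma P_setI S T U : pattern S -> pattern U -> pnormal T U -> S \subset U ->
  P F S :&: P F T = P F (S :&: T).
Proof.
move=> pS pU nT SU; have pT := pattern_normal nT.
have [_ TU nTP] := pnormalP _ _ nT.
have nST b c d : b \in T -> c \in S -> rdir b c d || rdir c b d -> d \in T.
  by move=> bT cS; apply: nTP => //; apply: (subsetP SU).
have pST : pattern (S :&: T).
  apply/patternP=> b c d /setIP[bS bT] /setIP[cS cT] bcd; apply/setIP; split.
    by move/patternP: pS => /(_ b c d); apply.
  by move/patternP: pT => /(_ b c d); apply.
have pU' : pattern (S :|: T).
  apply/patternP=> b c d /setUP[bS|bT] /setUP[cS|cT] bcd; apply/setUP.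
  - by left; move/patternP: pS => /(_ b c d); apply.
  - by right; apply: (nST c b) => //; rewrite bcd orbT.
  - by right; apply: (nST b c) => //; rewrite bcd.
  by right; move/patternP: pT => /(_ b c d); apply.
apply/esym/eqP; rewrite eqEcard subsetI !P_mono ?subsetIl ?subsetIr //=.
have F0 : (0 < #|F|)%N by apply/card_gt0P; exists 0%R.
have F1 : (0 < #|F| ^ #|S :|: T|)%N by rewrite expn_gt0 F0.
rewrite -(leq_pmul2l F1) -{1}(card_P pU') -(P_mul nST) -mul_cardG !card_P //.
by rewrite -!expnD cardsUI.
Qed.

End Factorization.

(** * Quotients of pattern groups *)

Section SemidirectQuotient.
Variables (gT : finGroupType) (G H K H1 K1 N : {group gT}).
Hypotheses (defG : K ><| H = G) (nH1 : H1 <| H) (nK1 : K1 <| K)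
  (nK1H : H \subset 'N(K1)) (cH1 : H1 \subset 'C(K / K1 | 'Q))
  (nN : N <| G) (defN : K1 * H1 = N).

Lemma quotient_acts : {acts H, on group K / K1 | 'Q}.
Proof.
have [_ _ nKH _] := sdprodP defG.
by split; [apply: actsQ | rewrite quotientS ?subsetT].
Qed.

Lemma quotient_act_exists : exists act : groupAction (H / H1) (K / K1),
  forall x y, x \in K -> y \in H ->
    act (coset K1 x) (coset H1 y) = coset K1 (x ^ y).
Proof.
pose act0 := actby_groupAction quotient_acts.
(* [mod_groupAction] acts on the fixed points of [H1]; as [H1] centralizes K / K1, these are all of
   K / K1. *)
have defR : 'C_(|act0)(H1) = K / K1.
  rewrite gacent_actby; apply/setIidPl.
  have /andP[_ cH1'] : (H1 \subset 'N(K1)) && (H1 / K1 \subset 'C(K / K1)).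
    by rewrite -sub_astabQ.
  by rewrite gacentQ centsC (subset_trans _ cH1') // quotientS // subsetIr.
have sH1 : H1 \subset 'C(K / K1 | act0).
  by rewrite astab_actby setIid subsetI cH1 normal_sub.
suff: exists act : groupAction (H / H1) 'C_(|act0)(H1),
    forall x y, x \in K -> y \in H ->
      act (coset K1 x) (coset H1 y) = coset K1 (x ^ y).
  by rewrite defR.
exists (mod_groupAction act0 H1) => x y Kx Hy.
have Ny := subsetP (normal_norm nH1) _ Hy.
rewrite modgactE; [|by []|by rewrite in_setI Hy].
rewrite [LHS]actbyE ?mem_quotient // qactJ.
have Nx1 : x \in 'N(K1) := subsetP (normal_norm nK1) _ Kx.
have Ny1 : y \in 'N(K1) := subsetP nK1H _ Hy.
by rewrite Ny1 morphJ.
Qed.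

(** The projections of K onto K / K1 and of H onto H / H1 are compatible with the actions, so they
    glue to a morphism from G onto the semidirect product. *)
Lemma sdprod_quotient_isog : exists act : groupAction (H / H1) (K / K1),
  (forall x y, x \in K -> y \in H ->
    act (coset K1 x) (coset H1 y) = coset K1 (x ^ y))
  /\ G / N \isog [set: sdprod_by act].
Proof.
have [act actE] := quotient_act_exists; exists act; split=> //.
have [sK1K nK1K] := andP nK1; have [sH1H nH1H] := andP nH1.
have [_ defKH nKH tiKH] := sdprodP defG.
have dK : K \subset 'dom (sdpair1 act \o coset K1).
  by rewrite /= -sub_quotient_pre.
have dH : H \subset 'dom (sdpair2 act \o coset H1).
  by rewrite /= -sub_quotient_pre.
pose fK := restrm_morphism dK (comp_morphism (coset_morphism K1)
  (sdpair1_morphism act)).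
pose fH := restrm_morphism dH (comp_morphism (coset_morphism H1)
  (sdpair2_morphism act)).
have actf : {in K & H, morph_act 'J 'J fK fH}.
  move=> x y Kx Hy; rewrite /= /restrm /= -actE // -sdpair_act //;
    exact: mem_quotient.
pose f := sdprodm_morphism defG actf.
have imf : f @* G = setT.
  rewrite im_sdprodm !morphim_restrm !setIid !morphim_comp.
  exact: im_sdpair.
have sNker : N \subset 'ker f.
  rewrite -defN mul_subG //; apply/subsetP=> x xN.
    have Kx : x \in K := subsetP sK1K _ xN.
    have Gx : x \in G by rewrite -(mulg1 x) -defKH mem_mulg.
    apply/(kerP _ Gx); rewrite /= sdprodmEl //= /restrm /= coset_id //= morph1
      //.
  have Hx : x \in H := subsetP sH1H _ xN.
  have Gx : x \in G by rewrite -(mul1g x) -defKH mem_mulg.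
  apply/(kerP _ Gx); rewrite /= sdprodmEr //= /restrm /= coset_id //= morph1 //.
have tiN : K1 :&: H1 = 1 by apply/trivgP; rewrite -tiKH setISS.
have cardQ (A B : {group gT}) : B <| A -> #|A / B| = (#|A| %/ #|B|)%N.
  by move=> nBA; rewrite card_quotient ?normal_norm // divgS ?normal_sub.
have c1 : #|sdpair1 act @* (K / K1)| = (#|K| %/ #|K1|)%N.
  by rewrite (card_injm (injm_sdpair1 act)) // cardQ.
have c2 : #|sdpair2 act @* (H / H1)| = (#|H| %/ #|H1|)%N.
  by rewrite (card_injm (injm_sdpair2 act)) // cardQ.
have cardGN : #|G / N| = #|[set: sdprod_by act]|.
  rewrite -(sdprod_card (sdprod_sdpair act)) c1 c2 cardQ //.
  rewrite -defN -defKH !TI_cardMg // -(Lagrange sK1K) -(Lagrange sH1H).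
  by rewrite mulnACA !mulKn ?muln_gt0 ?cardG_gt0.
(* The kernel contains [N], and G / N has the order of the image, so the two coincide. *)
have kerE : 'ker f = N.
  apply/esym/eqP; rewrite eqEcard sNker /=.
  have eqc : (#|G| %/ #|'ker f| = #|G| %/ #|N|)%N.
    rewrite -!cardQ ?ker_normal // cardGN.
    apply: eq_trans (card_isog (first_isog f)) _.
    exact: (congr1 (fun A : {set _} => #|A|) imf).
  have NG : #|N| %| #|G| by rewrite cardSg // normal_sub.
  have m0 : (0 < #|G| %/ #|N|)%N.
    rewrite divn_gt0; last exact: cardG_gt0 N.
    by apply: dvdn_leq NG; exact: cardG_gt0 G.
  apply/eq_leq/eqP; rewrite -(eqn_pmul2l m0) divnK //.
  by rewrite -eqc divnK // cardSg // subsetIl.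
rewrite -kerE; apply: isog_trans (first_isog f) _.
have imfT : f @* G = [set: sdprod_by act] := imf.
by rewrite -[X in _ \isog X]imfT isog_refl.
Qed.
End SemidirectQuotient.

Section PatternQuotients.
Variables (n : nat) (F : finFieldType).
Implicit Types (b c d : posroot n) (S N T U : {set posroot n}).

Lemma P_second_isog S N U : pattern S -> pnormal N U -> S :|: N = U ->
  P F S / P F (S :&: N) \isog P F U / P F N.
Proof.
move=> pS nN defU; have [pU NU nNP] := pnormalP _ _ nN.
have SU : S \subset U by rewrite -defU subsetUl.
have nPN := P_normal F nN.
have nPS : P F S \subset 'N(P F N) :=
  subset_trans (P_mono F SU) (normal_norm nPN).
rewrite -(P_setI F pS pU nN SU) setIC -defU P_setU norm_joinEl //.
exact: weak_second_isog.
Qed.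

(** The two images are normal and meet trivially by [P_setI]; their commutators lie in the
    intersection, so they commute. *)
Lemma P_quotient_dprod S N1 N2 U : pnormal N1 U -> pnormal N2 U ->
  pnormal S U -> N1 :|: N2 = U -> N1 :&: N2 = S ->
  (P F N1 / P F S) \x (P F N2 / P F S) = P F U / P F S.
Proof.
move=> nN1 nN2 nS defU defS; have [pU N1U _] := pnormalP _ _ nN1.
have [_ N2U nNP] := pnormalP _ _ nN2.
have [nP1 nP2 nPS] := And3 (P_normal F nN1) (P_normal F nN2) (P_normal F nS).
have SN1 : S \subset N1 by rewrite -defS subsetIl.
have SN2 : S \subset N2 by rewrite -defS subsetIr.
have [N1U' N2U'] := conj (P_mono F N1U) (P_mono F N2U).
have ti : (P F N1 / P F S) :&: (P F N2 / P F S) = 1.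
  rewrite -quotientIG ?P_mono // (P_setI F (pattern_normal nN1) pU nN2 N1U)
    defS.
  exact: trivg_quotient.
rewrite dprodE //.
  rewrite -quotientMl ?(subset_trans (normal_sub nP1)) ?normal_norm //.
  rewrite P_mul ?defU // => b c d bN cN; apply: nNP => //.
  exact: (subsetP N1U).
apply/commG1P/trivgP; rewrite -ti setIC commg_subI // subsetI subxx /=.
  by apply: subset_trans (quotientS _ N2U') _;
    rewrite quotient_norms // normal_norm.
by apply: subset_trans (quotientS _ N1U') _;
  rewrite quotient_norms // normal_norm.
Qed.

Lemma Xroot_quotient_isog b S U : pnormal S U -> b \in U -> b \notin S ->
  Xroot F b \isog P F (b |: S) / P F S.
Proof.
move=> nS bU bS; have [pU SU nSP] := pnormalP _ _ nS.
have nPS := P_normal F nS; have bU' := sub_Xroot_P F bU.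
have nbS : Xroot F b \subset 'N(P F S) := subset_trans bU' (normal_norm nPS).
have ti : P F S :&: Xroot F b = 1.
  have pb : pattern [set b].
    apply/patternP=> c d e /set1P-> /set1P->; rewrite /rdir.
    have [? ? ?] := root_bounds b; have -> : (rj b == ri b) = false by lia.
    by case: (isplus b).
  rewrite setIC -P_set1 (P_setI F pb pU nS) ?sub1set //.
  rewrite (_ : _ :&: _ = set0) ?P_set0 //; apply/setP=> c; rewrite !inE.
  by case: eqP => // ->; rewrite (negPf bS).
rewrite P_setU P_set1 norm_joinEl // quotientMidr.
by have := second_isog nbS; rewrite ti; apply: isog_trans (quotient1_isog _).
Qed.

Lemma P_cent S T :
  (forall b c d, b \in S -> c \in T -> ~~ (rdir b c d || rdir c b d)) ->
  P F S \subset 'C(P F T).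
Proof.
move=> H; apply/(P_subP _ [group of 'C(P F T)])=> b s bS.
rewrite /= -sub1set centsC; apply/(P_subP _ [group of 'C([set xroot b s])]) =>
  c t cT.
rewrite /= cent_set1; apply/cent1P/esym/commgP/conjg_fixP.
case: (xroot_conj b c s t) => // -[d [r [bcd _]]].
by case/negP: (H b c d bS cT).
Qed.

End PatternQuotients.

(** * The quotients of S_alpha in parts (a) to (d) *)

Section SubquotientsOfS.
Variables (n i : nat) (F : finFieldType) (alpha : posroot n).
Hypotheses (hi : (1 < i <= n)%N) (ri_alpha : ri alpha = 1%N)
  (rj_alpha : rj alpha = i) (plus_alpha : isplus alpha).

Local Notation L := (lset n i :|: kiset n i).
Local Notation DO := (dset n i :|: obset n i).

Lemma dset_obset_setU : DO :|: (alpha |: L) = sset n i.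
Proof. by rewrite setUCA -sset_decomp. Qed.

Lemma dset_obset_setI : DO :&: (alpha |: L) = DO :&: kiset n i.
Proof.
apply/setP=> b; have [? ? ?] := root_bounds b.
rewrite !inE (eq_alpha ri_alpha rj_alpha plus_alpha); lia.
Qed.

(** Together with alpha, [lset] and k(alpha), the sets [dset] and [obset] exhaust [sset], so the
    second isomorphism theorem applies. *)
Lemma Tbar_isog_dset_obset :
  P F (sset n i) / P F (alpha |: L) \isog P F DO / P F (DO :&: kiset n i).
Proof.
rewrite isog_sym -dset_obset_setI; apply: P_second_isog dset_obset_setU.
  exact: pattern_dset_obset.
exact: alpha_lset_kiset_normal.
Qed.

(** Modulo P(L) the group is the direct product of the images of P(sset minus alpha) and of X_alpha;
    the first image is again a copy of P(sset) modulo P(alpha |: L). *)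
Lemma Salpha_quotient_isog :
  P F (sset n i) / P F L \isog
  setX (P F (sset n i) / P F (alpha |: L)) (Xroot F alpha).
Proof.
have defS : alpha |: (DO :|: L) = sset n i by rewrite -sset_decomp.
have nM := sset_setD1_normal hi;
  have nT := alpha_lset_kiset_normal hi ri_alpha rj_alpha plus_alpha.
have nL := lset_kiset_normal hi.
have aL : alpha \notin L by rewrite !inE; lia.
have aS : alpha \in sset n i by rewrite !inE; lia.
have defU : (DO :|: L) :|: (alpha |: L) = sset n i.
  by rewrite setUCA -setUA setUid.
have defI : (DO :|: L) :&: (alpha |: L) = L.
  apply/setP=> b; have [? ? ?] := root_bounds b.
  by rewrite !inE (eq_alpha ri_alpha rj_alpha plus_alpha); lia.
have := P_quotient_dprod F nM nT nL defU defI.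
move/isog_dprod/(_ (setX_dprod [group of P F (sset n i) / P F (alpha |: L)]
  (Xroot_group F alpha))).
apply.
  apply: isog_trans (isog_setX1 _ _).
  by have := P_second_isog F (pattern_normal nM) nT defU; rewrite defI.
apply: isog_trans (isog_set1X _ _).
by rewrite isog_sym; apply: Xroot_quotient_isog nL aS aL.
Qed.

Lemma kiset_normal_sset : P F (kiset n i) <| P F (sset n i).
Proof.
apply: normalS (P_normal F (kiset_normal hi)); apply: P_mono;
  last exact: subsetT.
by apply/subsetP=> b; have [? ? ?] := root_bounds b; rewrite !inE; lia.
Qed.

Lemma Salpha_quotients :
  [/\ P F L <| P F (sset n i), P F (kiset n i) <| P F (sset n i),
      ((P F (lset n i) * P F (kiset n i)) / P F (kiset n i))
        <| (P F (sset n i) / P F (kiset n i)),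
      P F (alpha |: L) <| P F (sset n i)
    & (P F (sset n i) / P F L
         \isog (P F (sset n i) / P F (kiset n i)) /
               ((P F (lset n i) * P F (kiset n i)) / P F (kiset n i)))
      /\ ((P F (sset n i) / P F (kiset n i)) /
            ((P F (lset n i) * P F (kiset n i)) / P F (kiset n i))
         \isog setX (P F (sset n i) / P F (alpha |: L)) (Xroot F alpha))].
Proof.
have nPL := P_normal F (lset_kiset_normal hi); have nPk := kiset_normal_sset.
have -> : P F (lset n i) * P F (kiset n i) = P F L.
  rewrite P_setU norm_joinEl //.
  apply: subset_trans (normal_norm (P_normal F (kiset_normal hi))).
  exact: P_mono (subsetT _).
have kL : P F (kiset n i) \subset P F L := P_mono F (subsetUr _ _).
have iso := third_isog kL nPk nPL; split=> //.
- exact: quotient_normal.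
- exact: (P_normal F (alpha_lset_kiset_normal hi ri_alpha rj_alpha plus_alpha)).
split; first by rewrite isog_sym.
exact: isog_trans iso Salpha_quotient_isog.
Qed.

Lemma dset_obset_sdprod_isog :
 [/\ P F (dset n i :&: kiset n i) <| P F (dset n i),
         P F (obset n i :&: kiset n i) <| P F (obset n i)
       & exists act : groupAction
                        (P F (dset n i) / P F (dset n i :&: kiset n i))
                        (P F (obset n i) / P F (obset n i :&: kiset n i)),
           (forall x y, x \in P F (obset n i) -> y \in P F (dset n i) ->
              act (coset (P F (obset n i :&: kiset n i)) x)
                  (coset (P F (dset n i :&: kiset n i)) y)
              = coset (P F (obset n i :&: kiset n i)) (x ^ y))
           /\ P F DO / P F (DO :&: kiset n i) \isog [set: sdprod_by act]].
Proof.
have nO := obset_normal hi; have nDk := dset_kiset_normal hi;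
  have nOk := obset_kiset_normal hi.
have pDO := pattern_dset_obset hi; have pD := pattern_dset hi.
have sOk : obset n i :&: kiset n i \subset obset n i := subsetIl _ _.
have nPOk := P_normal F nOk.
have nPOk' : P F (obset n i :&: kiset n i) <| P F (obset n i).
  by apply: normalS nPOk; rewrite P_mono // subsetUr.
have nPDk := P_normal F nDk; split=> //.
have ti : P F (obset n i) :&: P F (dset n i) = 1.
  rewrite setIC (P_setI F pD pDO nO) ?subsetUl //.
  by rewrite dset_obset // P_set0.
have defG : P F (obset n i) ><| P F (dset n i) = P F DO.
  have nDO : P F (dset n i) \subset 'N(P F (obset n i)).
    apply: subset_trans (normal_norm (P_normal F nO)).
    by rewrite P_mono // subsetUl.
  by rewrite sdprodE // setUC P_setU norm_joinEr.
have nN : P F (DO :&: kiset n i) <| P F DO.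
  exact: P_normal (dset_obset_kiset_normal hi).
have defN : P F (obset n i :&: kiset n i) * P F (dset n i :&: kiset n i) =
   P F (DO :&: kiset n i).
  rewrite setIUl [in RHS]setUC P_setU norm_joinEr //.
  apply: subset_trans (normal_norm nPOk); apply: P_mono.
  by rewrite subIset // subsetUl.
apply: (sdprod_quotient_isog defG nPDk nPOk' _ _ nN defN).
  apply: subset_trans (normal_norm nPOk).
  by rewrite P_mono // subsetUl.
have nD : P F (dset n i :&: kiset n i) \subset P F DO.
  by rewrite P_mono // subIset // subsetUl.
rewrite sub_astabQR ?(subset_trans nD) ?normal_norm //.
(* It remains that P(dset :&: kiset) centralizes the quotient of P(obset): for i = n that quotient
   is trivial, and for i < n no sums of roots occur. *)
have [ein|ltin] := eqVneq i n.
  have -> : obset n i :&: kiset n i = obset n i.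
    by rewrite obset_kiset // ein eqxx.
  by rewrite commg_subr (subset_trans nD) // normal_norm // P_normal.
apply: subset_trans (sub1G _); apply/trivgP/commG1P/P_cent => b c d.
by apply: dset_kiset_obset_nosum => //; rewrite ltn_neqAle ltin; case/andP: hi.
Qed.

Lemma kobset_centralizes : (i < n)%N ->
  P F (kobset n i)
    \subset 'C(P F (obset n i) / P F (obset n i :&: kiset n i) | 'Q).
Proof.
move=> ltin; have Ok1 : P F (obset n i :&: kiset n i) = 1.
  by rewrite obset_kiset // (ltn_eqF ltin) P_set0.
rewrite sub_astabQ quotient_cents ?andbT; last first.
  by apply: P_cent => b c d; apply: kobset_obset_nosum.
by rewrite /= Ok1 norms1.
Qed.

Lemma obset_quotient1 :
  i = n -> P F (obset n i) / P F (obset n i :&: kiset n i) = 1.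
Proof.
move=> ein; have -> : obset n i :&: kiset n i = obset n i.
  by rewrite obset_kiset // ein eqxx.
exact: trivg_quotient.
Qed.

End SubquotientsOfS.

(** * Principal submatrices *)

Section MxsubMorphism.
Variables (F : finFieldType) (N m : nat) (f : 'I_m.-1.+1 -> 'I_N.-1.+1).
Variable D : {group {'GL_N[F]}}.
Hypothesis injf : injective f.
(** No product passes from one kept index to another through a deleted one, which makes taking the
    submatrix multiplicative. *)
Hypothesis Df : forall g h p q k, g \in D -> h \in D -> k \notin codom f ->
  (GLval g (f p) k * GLval h k (f q) = 0)%R.

(* The value is 1 if the submatrix is singular, which does not happen on D. *)
Definition mxsubGL (g : {'GL_N[F]}) : {'GL_m[F]} :=
  let u1 : {'GL_m[F]} := 1 in odflt u1 (insub (mxsub f f (GLval g))).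

Lemma mxsub_GL_mul g h : g \in D -> h \in D ->
  mxsub f f (GLval (g * h)) = (mxsub f f (GLval g) *m mxsub f f (GLval h))%R.
Proof.
move=> gD hD; apply/matrixP=> p q; rewrite [LHS]mxE GL_MxE !mxE.
rewrite (bigID [in codom f]) /= [X in (_ + X)%R]big1 ?addr0 => [|k kf];
  last first.
  exact: Df.
rewrite -big_uniq; last by rewrite map_inj_uniq ?enum_uniq.
rewrite big_map big_enum /=.
by apply: eq_bigr => k _; rewrite !mxE.
Qed.

Lemma mxsub_GL_unit g : g \in D -> mxsub f f (GLval g) \is a GRing.unit.
Proof.
move=> gD; have : (mxsub f f (GLval g) *m mxsub f f (GLval g^-1) = 1%:M)%R.
  rewrite -mxsub_GL_mul ?groupV // mulgV GL_1E.
  by apply/matrixP=> p q; rewrite !mxE (inj_eq injf).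
by case/mulmx1_unit.
Qed.

Lemma mxsubGLE g p q : g \in D -> GLval (mxsubGL g) p q = GLval g (f p) (f q).
Proof.
move=> gD; rewrite /mxsubGL; case: insubP => [u _ ->|]; first by rewrite mxE.
by rewrite mxsub_GL_unit.
Qed.

Lemma mxsubGLM : {in D &, {morph mxsubGL : g h / g * h}}.
Proof.
move=> g h gD hD; apply: val_inj; apply/matrixP=> p q.
rewrite [LHS](mxsubGLE _ _ (groupM gD hD)).
transitivity (mxsub f f (GLval (g * h)) p q); first by rewrite [RHS]mxE.
transitivity ((GLval (mxsubGL g) *m GLval (mxsubGL h))%R p q) => //.
rewrite mxsub_GL_mul // mxE [RHS]mxE; apply: eq_bigr => k _.
by rewrite ![mxsub _ _ _ _ _]mxE !mxsubGLE.
Qed.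

Definition mxsub_morphism := Morphism mxsubGLM.

End MxsubMorphism.

Section Support.
Variables (n : nat) (F : finFieldType) (S : {set posroot n}).
Local Notation I := 'I_((n.*2).-1.+1).
Variable R : rel I.
Hypotheses (Rtr : transitive R)
  (RS : forall b p q, b \in S -> ~~ R p q -> rootmx F b p q = 0%R).

(** By transitivity of [R], matrices that agree with the identity outside [R] are closed under
    products. *)
Lemma P_support g p q : g \in P F S -> ~~ R p q -> GLval g p q = (p == q)%:R%R.
Proof.
move=> gP; move: g gP p q.
apply: (P_ind (Q := fun g => forall p q, ~~ R p q ->
  GLval g p q = (p == q)%:R%R)).
- by move=> p q _; rewrite GL_1E mxE.
- move=> g h Hg Hh p q npq; rewrite GL_MxE mxE.
  have term0 k : k != p -> (GLval g p k * GLval h k q = 0)%R.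
    move=> nkp; have [Rpk|nRpk] := boolP (R p k); last first.
      by rewrite Hg // eq_sym (negPf nkp) mul0r.
    have nRkq : ~~ R k q by apply: contra npq; apply: Rtr Rpk.
    rewrite Hh //; have [kq|_] := eqVneq k q; last by rewrite mulr0.
    by rewrite -kq Rpk in npq.
  rewrite (bigD1 p) //= big1 ?addr0 // Hh //.
  have [epq|_] := eqVneq p q; last by rewrite mulr0.
  by move: npq; rewrite -epq => npp; rewrite Hg // eqxx mulr1.
by move=> b t bS p q npq; rewrite xrootE RS ?mulr0 ?addr0.
Qed.

End Support.

Section UAcard.
Variables (F : finFieldType) (m : nat) (T : finType) (u v : T -> 'I_m.+1).
Hypothesis uv : forall p q : 'I_m.+1, (p < q)%N -> exists t, u t = p /\ v t = q.

(** A unitriangular matrix is determined by its entries above the diagonal, all of which [T] lists.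
    The bound turns injective morphisms into UA into isomorphisms by comparison of orders. *)
Lemma leq_card_UA : (#|UA m F| <= #|F| ^ #|T|)%N.
Proof.
pose e (g : {'GL_m.+1[F]}) := [ffun t : T => GLval g (u t) (v t) : F].
rewrite -card_ffun -(card_in_imset (f := e) (D := [in UA m F]));
  first exact: max_card.
move=> g h; rewrite !inE => gU hU eq_gh; apply: val_inj; apply/matrixP=> p q /=.
have UAP (k : {'GL_m.+1[F]}) : [forall p : 'I_m.+1, forall q : 'I_m.+1,
     (q <= p)%N ==> (GLval k p q == (p == q)%:R)]%R ->
   forall p q : 'I_m.+1, (q <= p)%N -> GLval k p q = (p == q)%:R%R.
  by move=> H p' q' le; apply/eqP; apply: implyP le;
    move/forallP: H => /(_ p')/forallP.
have [lt|le] := ltnP p q; last by rewrite (UAP g) ?(UAP h).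
have [t [<- <-]] := uv lt.
by have := congr1 (fun w : {ffun T -> F} => w t) eq_gh; rewrite !ffunE.
Qed.
End UAcard.

Lemma isog_quotient (aT rT : finGroupType) (D H : {group aT})
    (f : {morphism D >-> rT}) : 'injm f -> H <| D ->
      D / H \isog f @* D / f @* H.
Proof.
move=> injf nHD; apply/isogP; exists (quotm_morphism f nHD).
  exact: injm_quotm.
exact: morphim_quotm.
Qed.

(** * Deleting the coordinates +-e_1 and +-e_i: the group UD_(n-2) *)

Section DeleteCoordinates.
Variables (n i : nat) (F : finFieldType).
Hypotheses (hn : (4 <= n)%N) (hi : (1 < i <= n)%N).
Implicit Types S : {set posroot n}.
Local Notation n' := (n - 2)%N.
Local Notation I := 'I_((n.*2).-1.+1).
Local Notation I' := 'I_((n'.*2).-1.+1).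

(* The increasing bijection from {1, ..., n - 2} onto the coordinates other
   than 1 and i. *)
Definition skip (k : nat) : nat := (k.+1 + (i <= k.+1))%N.

(** The extension of [skip] to all positions that commutes with e_k -> -e_k. *)
Definition skip_pos (p : nat) : nat :=
  if (p < n')%N then skip p.+1 else opp_pos n (skip (opp_pos n' p.+1)).

Definition skip_ord (p : I') : I := inord (skip_pos p).-1.

Lemma skip_ordE p : (skip_ord p).+1 = skip_pos p.
Proof.
have := ltn_ord p; rewrite /skip_ord /skip_pos /opp_pos /skip => hp.
by rewrite inordK; case: ifP; lia.
Qed.

Lemma skip_proof (b : posroot n') :
  (0 < (inord (skip (ri b)) : 'I_n.+1) < (inord (skip (rj b)) : 'I_n.+1))%N.
Proof.
have [? ? ?] := root_bounds b; rewrite /skip !inordK; lia.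
Qed.

Definition skip_root (b : posroot n') : posroot n :=
  @PosRoot n (inord (skip (ri b)), inord (skip (rj b)),
    isplus b) (skip_proof b).

Lemma skip_rootE b : [/\ ri (skip_root b) = skip (ri b),
  rj (skip_root b) = skip (rj b) & isplus (skip_root b) = isplus b].
Proof.
have [? ? ?] := root_bounds b.
by split=> //; rewrite /ri /rj /= inordK // /skip; lia.
Qed.

Lemma skip_root_dset b : skip_root b \in dset n i.
Proof.
have [? ? ?] := root_bounds b; have [e1 e2 _] := skip_rootE b.
by rewrite inE e1 e2 /skip; lia.
Qed.

Lemma dset_skip_root c : c \in dset n i -> exists b, skip_root b = c.
Proof.
rewrite inE => cd; have [? ? ?] := root_bounds c.
have [||b [b1 b2 b3]] := @posroot_ex n' ((ri c).-1 - (i < ri c)) ((rj c).-1 -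
  (i < rj c)) (isplus c).
- lia.
- lia.
exists b; apply/eqP; have [e1 e2 e3] := skip_rootE b.
by rewrite posroot_eqE e1 e2 e3 b1 b2 b3 /skip eqxx; lia.
Qed.

Lemma rdir_skip b c d :
  rdir (skip_root b) (skip_root c) (skip_root d) = rdir b c d.
Proof.
have eq_skip k l : (skip k == skip l) = (k == l) by rewrite /skip; lia.
have [b1 b2 b3] := skip_rootE b; have [c1 c2 c3] := skip_rootE c.
have [d1 d2 d3] := skip_rootE d.
by rewrite /rdir b1 b2 b3 c1 c2 c3 d1 d2 d3 !eq_skip.
Qed.

Lemma skip_pos_eq (p : I') k : (0 < k <= n')%N ->
  (skip_pos p == skip k) = (p.+1 == k).
Proof.
have := ltn_ord p; rewrite /skip_pos /opp_pos /skip => hp hk.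
by case: ifP; lia.
Qed.

Lemma skip_pos_opp_eq (p : I') k : (0 < k <= n')%N ->
  (skip_pos p == opp_pos n (skip k)) = (p.+1 == opp_pos n' k).
Proof.
have := ltn_ord p; rewrite /skip_pos /opp_pos /skip => hp hk.
by case: ifP; lia.
Qed.

Lemma rootmx_skip b p q :
  rootmx F (skip_root b) (skip_ord p) (skip_ord q) = rootmx F b p q.
Proof.
have [? ? ?] := root_bounds b; have [e1 e2 e3] := skip_rootE b.
rewrite /rootmx e1 e2 e3.
by case: (isplus b); rewrite !mxE !skip_ordE ?skip_pos_eq ?skip_pos_opp_eq //;
  lia.
Qed.

Lemma skip_ord_inj : injective skip_ord.
Proof.
move=> p q /(congr1 (fun k : I => k.+1)); rewrite !skip_ordE => epq.
apply: val_inj => /=; move: epq; have := ltn_ord p; have := ltn_ord q.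
by rewrite /skip_pos /opp_pos /skip; do 2!case: ifP; lia.
Qed.

Definition kept (k : I) : bool :=
  [&& k.+1 != 1, k.+1 != i, k.+1 != opp_pos n 1 & k.+1 != opp_pos n i]%N.

Lemma unskip l : (1 < l <= n)%N -> l != i ->
  exists2 m, (0 < m <= n')%N & skip m = l.
Proof.
by move=> hl li; exists (l.-1 - (i < l))%N; rewrite /skip; lia.
Qed.

Lemma kept_codom k : kept k -> k \in codom skip_ord.
Proof.
have := ltn_ord k; rewrite /kept => lk /and4P[k1 k2 k3 k4].
suff [p hp eqp] : exists2 p : nat, (p < (n'.*2).-1.+1)%N & skip_pos p = k.+1.
  apply/codomP; exists (Ordinal hp); apply: val_inj; apply: succn_inj.
  by rewrite [RHS]skip_ordE.
have [ltkn|lenk] := ltnP k n.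
  have [||m hm eqm] := @unskip k.+1; [lia|lia|].
  exists m.-1; first lia.
  rewrite /skip_pos (_ : m.-1.+1 = m); last lia.
  by have [_ ->] := andP hm.
have [||m hm eqm] := @unskip (opp_pos n k.+1).
- by move: k3; rewrite /opp_pos; lia.
- by move: k4; rewrite /opp_pos; lia.
exists (opp_pos n' m).-1; first by rewrite /opp_pos; lia.
rewrite /skip_pos (_ : _.-1.+1 = opp_pos n' m); last by rewrite /opp_pos; lia.
rewrite (_ : (opp_pos n' m <= n')%N = false); last by rewrite /opp_pos; lia.
rewrite (_ : opp_pos n' (opp_pos n' m) = m) ?eqm /opp_pos; lia.
Qed.

Definition kept2 : rel I := fun p q => kept p && kept q.

Lemma kept2_trans : transitive kept2.
Proof. by move=> p q r /andP[qp _] /andP[_ pr]; apply/andP. Qed.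

Lemma rootmx_dset b p q : b \in dset n i -> ~~ kept2 p q ->
  rootmx F b p q = 0%R.
Proof.
have [? ? ?] := root_bounds b; rewrite inE => bd npq.
rewrite /rootmx; case: ifP => _; rewrite !mxE; apply: natr_bool_sub0;
  apply: contra npq => /andP[/eqP e1 /eqP e2];
  rewrite /kept2 /kept e1 e2 /opp_pos; lia.
Qed.

Lemma skip_mul0 g h p q k : g \in P F (dset n i) -> h \in P F (dset n i) ->
  k \notin codom skip_ord -> (GLval g (skip_ord p) k * GLval h k (skip_ord q)
    = 0)%R.
Proof.
move=> gd _ kN; rewrite (P_support kept2_trans rootmx_dset gd); last first.
  by apply: contra kN => /andP[_]; apply: kept_codom.
case: eqP => [e|_]; last by rewrite mul0r.
by rewrite -e codom_f in kN.
Qed.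

Definition skip_morph := mxsub_morphism skip_ord_inj skip_mul0.

Lemma skip_morphE g p q : g \in P F (dset n i) ->
  GLval (skip_morph g) p q = GLval g (skip_ord p) (skip_ord q).
Proof. exact: (mxsubGLE skip_ord_inj skip_mul0). Qed.

Lemma skip_morph_xroot b (t : F) : skip_morph (xroot (skip_root b) t) = xroot
  b t.
Proof.
apply: val_inj; apply/matrixP=> p q.
rewrite [LHS]skip_morphE ?xroot_P ?skip_root_dset // [RHS]xrootE xrootE.
by rewrite (inj_eq skip_ord_inj) rootmx_skip.
Qed.

(** An element of P(dset n i) agrees with the identity outside the kept coordinates, so its
    submatrix determines it. *)
Lemma skip_morph_inj : 'injm skip_morph.
Proof.
apply/subsetP=> g; rewrite !inE => /andP[gd /eqP g1]; apply/eqP.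
apply: val_inj; apply/matrixP=> p q /=.
have [/andP[/kept_codom/codomP[p' ->] /kept_codom/codomP[q' ->]]|nk] :=
  boolP (kept2 p q).
  rewrite -skip_morphE // g1 [RHS]mxE mxE (inj_eq skip_ord_inj) //.
by rewrite (P_support kept2_trans rootmx_dset gd) // [RHS]mxE.
Qed.

Lemma morphim_skip_morph S : S \subset dset n i ->
  skip_morph @* P F S = P F (skip_root @^-1: S).
Proof.
move=> /subsetP Sd; have SD : P F S \subset P F (dset n i).
  by apply: P_mono; apply/subsetP.
apply/eqP; rewrite eqEsubset; apply/andP; split.
  rewrite sub_morphim_pre //.
  apply/(P_subP _ [group of skip_morph @*^-1 (P F (skip_root @^-1: S))]) =>
    b t bS.
  have [c def_b] := dset_skip_root (Sd b bS); rewrite -{b}def_b in bS *.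
  apply/morphpreP; split; first by rewrite xroot_P ?Sd.
  by rewrite skip_morph_xroot xroot_P // inE.
apply/(P_subP _ [group of skip_morph @* P F S]) => b t; rewrite inE => bS.
rewrite -skip_morph_xroot mem_morphim ?xroot_P //; exact: Sd.
Qed.

Lemma dset_UD_isog : P F (dset n i) \isog UD n' F.
Proof.
have -> : UD n' F = skip_morph @* P F (dset n i).
  rewrite morphim_skip_morph //; congr (P F _); apply/setP=> b.
  by rewrite inE [RHS]inE skip_root_dset.
by have := sub_isog (subxx _) skip_morph_inj.
Qed.

Lemma dset_quotient_UD_isog S : pnormal S (dset n i) ->
  P F (dset n i) / P F S \isog UD n' F / P F (skip_root @^-1: S).
Proof.
move=> nS; have [_ Sd _] := pnormalP _ _ nS.
have := isog_quotient skip_morph_inj (P_normal F nS).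
rewrite !morphim_skip_morph //=.
have -> : skip_root @^-1: dset n i = setT.
  by apply/setP=> b; rewrite !inE; have := skip_root_dset b; rewrite inE.
by [].
Qed.

Lemma skip_root_pnormal S : pnormal S (dset n i) ->
  pnormal (skip_root @^-1: S) setT.
Proof.
case/pnormalP=> _ _ H; apply/pnormalP; split=> [||b c d].
- exact: patternT.
- exact: subsetT.
rewrite !inE => bS _ bcd; apply: H bS (skip_root_dset c) _.
by rewrite !rdir_skip.
Qed.

End DeleteCoordinates.

Lemma rootmx_upper n (F : finFieldType) (b : posroot n)
    (p q : 'I_((n.*2).-1.+1)) :
  ~~ (p < q)%N -> rootmx F b p q = 0%R.
Proof.
have [? ? ?] := root_bounds b; move=> npq.
rewrite /rootmx; case: ifP => _; rewrite !mxE; apply: natr_bool_sub0;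
  apply: contra npq => /andP[/eqP e1 /eqP e2];
  move: e1 e2; rewrite /opp_pos; lia.
Qed.

(** * Keeping the coordinates e_2, ..., e_(i-1): the group UA_(i-3) *)

Section UpperBlock.
Variables (n i : nat) (F : finFieldType).
Hypotheses (hi : (1 < i <= n)%N) (hi3 : (3 < i)%N).
Local Notation I := 'I_((n.*2).-1.+1).
Local Notation I' := 'I_((i - 3).+1.-1.+1).

(** The coordinate e_2 has position 1 when counted from 0, whence the shift by one. *)
Definition block_ord (p : I') : I := inord p.+1.

Lemma block_ordE p : block_ord p = p.+1 :> nat.
Proof.
by have := ltn_ord p; rewrite /block_ord /= => hp; rewrite inordK; lia.
Qed.

Lemma block_ord_inj : injective block_ord.
Proof.
by move=> p q /(congr1 val) /=; rewrite !block_ordE => -[] /val_inj.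
Qed.

Lemma block_codom (k : I) : (0 < k < i.-1)%N -> k \in codom block_ord.
Proof.
move=> hk; have hp : (k.-1 < (i - 3).+1.-1.+1)%N by lia.
apply/codomP; exists (Ordinal hp); apply: val_inj; rewrite [RHS]block_ordE /=;
  lia.
Qed.

Definition ord_lt : rel I := fun p q => (p < q)%N.

Lemma ord_lt_trans : transitive ord_lt.
Proof. by move=> p q r; apply: ltn_trans. Qed.

Lemma P_upper S g (p q : I) : g \in P F S -> (q <= p)%N ->
  GLval g p q = (p == q)%:R%R.
Proof.
move=> gS le; apply: (P_support ord_lt_trans _ gS);
  last by rewrite /ord_lt -leqNgt.
by move=> b p' q' _; apply: rootmx_upper.
Qed.

(** The kept indices are consecutive, so a deleted [k] is not strictly between two of them, and one
    of the two entries lies below the diagonal. *)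
Lemma block_mul0 g h p q k : g \in P F (midset n i) -> h \in P F (midset n i) ->
  k \notin codom block_ord ->
  (GLval g (block_ord p) k * GLval h k (block_ord q) = 0)%R.
Proof.
move=> gS hS kN; have kp : block_ord p != k.
  by apply: contraNneq kN => <-; apply: codom_f.
have kq : k != block_ord q by apply: contraNneq kN => ->; apply: codom_f.
have [lek|ltk] := leqP k (block_ord p).
  by rewrite (P_upper gS) // (negPf kp) mul0r.
rewrite (P_upper hS) ?(negPf kq) ?mulr0 //.
rewrite leqNgt; apply: contra kN => ltq; apply: block_codom.
have := ltn_ord q; move: ltq ltk; rewrite !block_ordE /=; lia.
Qed.

Definition block_morph := mxsub_morphism block_ord_inj block_mul0.

Lemma block_morphE g p q : g \in P F (midset n i) ->
  GLval (block_morph g) p q = GLval g (block_ord p) (block_ord q).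
Proof. exact: (mxsubGLE block_ord_inj block_mul0). Qed.

Lemma midset_rootpos b : b \in midset n i -> exists p q : I',
  [/\ (p < q)%N, rootrow b = block_ord p & rootcol b = block_ord q].
Proof.
have [? ? ?] := root_bounds b; rewrite inE => /and3P[b1 b2 /negPf b3].
have hp : ((ri b).-2 < (i - 3).+1.-1.+1)%N by lia.
have hq : ((rj b).-2 < (i - 3).+1.-1.+1)%N by lia.
exists (Ordinal hp), (Ordinal hq); split; first by rewrite /=; lia.
  by apply: val_inj; rewrite /= block_ordE rootrowE /=; lia.
by apply: val_inj; rewrite /= block_ordE rootcolE b3 /=; lia.
Qed.

(** The positions of the roots of [midset] all lie in the block, so [P_entries0] applies. *)
Lemma block_morph_inj : 'injm block_morph.
Proof.
apply/subsetP=> g; rewrite !inE => /andP[gS /eqP g1]; apply/eqP.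
apply: (P_entries0 _ gS); first exact: pattern_midset.
move=> b /midset_rootpos[p [q [ltpq -> ->]]].
by rewrite -block_morphE // g1 mxE -val_eqE /= ltn_eqF.
Qed.

Lemma midset_UA_isog : P F (midset n i) \isog UA (i - 3) F.
Proof.
have -> : UA (i - 3) F = block_morph @* P F (midset n i).
  apply/esym/eqP; rewrite eqEcard; apply/andP; split.
    apply/subsetP=> _ /morphimP[g gS _ ->]; rewrite inE.
    apply/forallP=> p; apply/forallP=> q; apply/implyP=> le.
    rewrite block_morphE // (P_upper gS) ?(inj_eq block_ord_inj) //.
    by rewrite !block_ordE.
  rewrite card_injm ?block_morph_inj // card_P ?pattern_midset //.
  pose T := {b : posroot n | b \in midset n i}.
  have -> : #|midset n i| = #|{: T}| by rewrite card_sig.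
  pose u (t : T) : 'I_(i - 3).+1 := inord (ri (val t)).-2.
  pose v (t : T) : 'I_(i - 3).+1 := inord (rj (val t)).-2.
  apply: (@leq_card_UA F _ T u v) => p q ltpq.
  have hp := ltn_ord p; have hq := ltn_ord q.
  (* Index p of the block, counted from 0, is the coordinate e_(p+2). *)
  have [||b [b1 b2 b3]] := @posroot_ex n p.+2 q.+2 false; [lia|lia|].
  have bS : b \in midset n i by rewrite inE; lia.
  exists (Sub b bS); rewrite /u /v /= b1 b2 /=.
  by split; apply: val_inj; rewrite /= inordK.
by have := sub_isog (subxx _) block_morph_inj.
Qed.

Lemma dset_quotient_UA_isog :
  P F (dset n i) / P F (kobset n i :|: (kiset n i :&: dset n i))
    \isog UA (i - 3) F.
Proof.
have defU : midset n i :|: (kobset n i :|: (kiset n i :&: dset n i)) = dset n i.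
  by apply/setP=> b; have [? ? ?] := root_bounds b; rewrite !inE; lia.
have defI : midset n i :&: (kobset n i :|: (kiset n i :&: dset n i)) = set0.
  by apply/setP=> b; have [? ? ?] := root_bounds b; rewrite !inE; lia.
have := P_second_isog F (pattern_midset hi) (kobset_kiset_normal hi) defU.
rewrite defI isog_sym => iso; apply: isog_trans iso _.
apply: isog_trans midset_UA_isog.
by rewrite P_set0 isog_sym; apply: quotient1_isog.
Qed.

End UpperBlock.

(** * Keeping the coordinates e_r and e_i: a product of copies of UA_1 *)

Section ObsetGroup.
Variables (n i : nat) (F : finFieldType).
Hypotheses (hi : (1 < i <= n)%N).
Local Notation I := 'I_((n.*2).-1.+1).

(* The positions (r, i) and (-i, -r) of the entries of P(obset n i) that are off
   the diagonal. *)
Definition ob_rel : rel I := fun p q =>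
  ((q == i.-1 :> nat) && (p < i.-1) || (p.+1 == opp_pos n i) && (p < q))%N.

Lemma ob_rel_trans : transitive ob_rel.
Proof. by move=> p q r; rewrite /ob_rel /opp_pos; lia. Qed.

Lemma rootmx_obset b p q : b \in obset n i -> ~~ ob_rel p q ->
  rootmx F b p q = 0%R.
Proof.
have [? ? ?] := root_bounds b; rewrite inE => /andP[/eqP bi /negPf bm] npq.
rewrite /rootmx bm !mxE; apply: natr_bool_sub0;
  apply: contra npq => /andP[/eqP e1 /eqP e2];
  move: e1 e2; rewrite /ob_rel /opp_pos bi; lia.
Qed.

(** As [r] is counted from 0, these are the positions of e_(r+1) and e_i. *)
Definition pair_ord (r : 'I_(i - 1)) (p : 'I_2) : I :=
  inord (if p == ord0 then r : nat else i.-1).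

Lemma pair_ordE r p :
  pair_ord r p = (if p == ord0 then r : nat else i.-1) :> nat.
Proof.
by have hr := ltn_ord r; rewrite /pair_ord inordK //; case: ifP => _; lia.
Qed.

Lemma pair_ord_inj r : injective (pair_ord r).
Proof.
move=> p q /(congr1 val) /=; rewrite !pair_ordE.
have hr := ltn_ord r; have hp := ltn_ord p; have hq := ltn_ord q.
rewrite -!val_eqE /= => e; apply: val_inj => /=.
move: e; do 2!case: ifP; lia.
Qed.

(** Off the diagonal, the row of e_(r+1) is supported in the column of e_i and the row of e_i is
    zero, so no deleted column is reached. *)
Lemma pair_mul0 r g h p q k : g \in P F (obset n i) -> h \in P F (obset n i) ->
  k \notin codom (pair_ord r) ->
  (GLval g (pair_ord r p) k * GLval h k (pair_ord r q) = 0)%R.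
Proof.
move=> gS hS kN; rewrite (P_support ob_rel_trans rootmx_obset gS); last first.
  apply: contra kN => H; apply/codomP; exists (Ordinal (isT : 1 < 2)%N).
  apply: val_inj; rewrite [RHS]pair_ordE /=.
  have hr := ltn_ord r; have hk := ltn_ord k.
  move: H; rewrite /ob_rel pair_ordE /opp_pos; case: ifP; lia.
by rewrite (_ : _ == k = false) ?mul0r //; apply: contraNF kN => /eqP<-;
  apply: codom_f.
Qed.

Definition pair_morph r :=
  mxsub_morphism (m := 2) (@pair_ord_inj r) (@pair_mul0 r).

Lemma pair_morphE r g p q : g \in P F (obset n i) ->
  GLval (pair_morph r g) p q = GLval g (pair_ord r p) (pair_ord r q).
Proof. exact: (mxsubGLE (m := 2) (@pair_ord_inj r) (@pair_mul0 r)). Qed.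

Definition pairs (g : {'GL_(n.*2)[F]}) :
    {dffun forall r : 'I_(i - 1), {'GL_2[F]}} :=
  [ffun r => pair_morph r g].

Lemma pairsM : {in P F (obset n i) &, {morph pairs : g h / g * h}}.
Proof. by move=> g h gS hS; apply/ffunP=> r; rewrite !ffunE morphM. Qed.

Definition pairs_morphism := Morphism pairsM.

Lemma pairs_inj : 'injm pairs_morphism.
Proof.
apply/subsetP=> g; rewrite !inE => /andP[gS /eqP/ffunP g1]; apply/eqP.
apply: (P_entries0 _ gS); first exact: pattern_obset.
move=> b; rewrite inE => /andP[/eqP bi /negPf bm];
  have [? ? ?] := root_bounds b.
have hr : ((ri b).-1 < i - 1)%N by lia.
have := g1 (Ordinal hr); rewrite !ffunE => /(congr1 (fun x : {'GL_2[F]} =>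
  GLval x (ord0 : 'I_2) (ord_max : 'I_2))).
rewrite pair_morphE // mxE /= => e0; rewrite -[RHS]e0; congr (GLval g _ _);
  apply: val_inj.
by rewrite /= rootcolE pair_ordE bm bi.
Qed.

Lemma obset_UA1_isog :
  P F (obset n i) \isog setXn (fun _ : 'I_(i - 1) => UA 1 F).
Proof.
have -> : setXn (fun _ : 'I_(i - 1) => UA 1 F) =
    pairs_morphism @* P F (obset n i).
  apply/esym/eqP; rewrite eqEcard; apply/andP; split.
    apply/subsetP=> _ /morphimP[g gS _ ->]; apply/setXnP=> r; rewrite ffunE inE.
    apply/forallP=> p; apply/forallP=> q; apply/implyP=> le.
    rewrite pair_morphE // (P_support ob_rel_trans rootmx_obset gS).
      by rewrite (inj_eq (@pair_ord_inj r)).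
    have hr := ltn_ord r; move: le; have := ltn_ord p; have := ltn_ord q.
    rewrite /ob_rel !pair_ordE -!val_eqE /= /opp_pos; do 2!case: ifP; lia.
  rewrite card_injm ?pairs_inj // card_P ?pattern_obset // cardsXn.
  (* Each UA_1 has a single entry above the diagonal, indexed by [unit], so the product has order at
     most q^(i-1), while [obset] has at least i - 1 roots. *)
  apply: (@leq_trans (\prod_(r < i - 1) #|F|)%N).
    apply: leq_prod => r _; rewrite -[leqRHS]expn1 -[1%N in leqRHS]card_unit.
    apply: (@leq_card_UA F _ unit (fun=> ord0) (fun=> ord_max)) => p q ltpq.
    exists tt; have := ltn_ord q; have := ltn_ord p.
    by split; apply: val_inj => /=; lia.
  rewrite prod_nat_const card_ord leq_exp2l; last exact: card_finNzRing_gt1.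
  have /fin_all_exists[h hP] (r : 'I_(i - 1)) :
      exists b : posroot n, [/\ ri b = r.+1, rj b = i & isplus b = false].
    by have hr := ltn_ord r; apply: posroot_ex; lia.
  rewrite -[leqLHS]card_ord -(card_imset (f := h)) => [|r s ers]; last first.
    have [hr _ _] := hP r; have [hs _ _] := hP s.
    by apply: val_inj; apply: succn_inj; rewrite -hr -hs ers.
  apply: subset_leq_card; apply/subsetP=> _ /imsetP[r _ ->].
  by have [_ e2 e3] := hP r; rewrite inE e2 e3 eqxx.
by have := sub_isog (subxx _) pairs_inj.
Qed.

End ObsetGroup.

Section SmallIndex.
Variables (n i : nat) (F : finFieldType).
Hypotheses (hn : (4 <= n)%N) (hi : (1 < i <= n)%N) (hi3 : (i <= 3)%N)
  (ltin : (i < n)%N).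

Lemma kobset_dset : kobset n i = dset n i.
Proof. apply/setP=> b; have [? ? ?] := root_bounds b; rewrite !inE; lia. Qed.

Lemma dset_obset_kiset0 : (dset n i :|: obset n i) :&: kiset n i = set0.
Proof. apply/setP=> b; have [? ? ?] := root_bounds b; rewrite !inE; lia. Qed.

(** For i <= 3 the set [kobset] is all of [dset], so P(dset) and P(obset) commute, and k(alpha)
    meets neither of them. *)
Lemma dset_obset_setX_isog (rT : finGroupType) (U : {group rT}) : P F (obset n
  i) \isog U ->
  P F (dset n i :|: obset n i) / P F ((dset n i :|: obset n i) :&: kiset n i)
    \isog setX (UD (n - 2) F) U.
Proof.
move=> isoU; have nO := obset_normal hi; have pDO := pattern_dset_obset hi.
have pD := pattern_dset hi.
have cDO : P F (obset n i) \subset 'C(P F (dset n i)).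
  rewrite centsC P_cent // => b c d; rewrite -kobset_dset;
    exact: kobset_obset_nosum.
have ti : P F (dset n i) :&: P F (obset n i) = 1.
  by rewrite (P_setI F pD pDO nO) ?subsetUl // dset_obset // P_set0.
have defG : P F (dset n i) \x P F (obset n i) = P F (dset n i :|: obset n i).
  by rewrite dprodE // P_setU cent_joinEr.
rewrite dset_obset_kiset0 P_set0.
apply: isog_trans (isog_dprod defG (setX_dprod (UD_group (n - 2) F) U) _ _).
- by rewrite isog_sym quotient1_isog.
- by apply: isog_trans (isog_setX1 _ _); apply: dset_UD_isog.
by apply: isog_trans isoU (isog_set1X _ _).
Qed.

End SmallIndex.

(** * Assembly of the statements (a) to (h) *)

Lemma e1ei_coords n i (alpha : posroot n) : (1 < i <= n)%N ->
  rvec alpha = (evec n 1 + evec n i)%R ->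
  [/\ ri alpha = 1%N, rj alpha = i & isplus alpha].
Proof.
move=> hi halpha; have [||b [b1 b2 b3]] := @posroot_ex n 1 i true; [lia|lia|].
suff -> : alpha = b by [].
by apply: rvec_inj; rewrite halpha /rvec b1 b2 b3.
Qed.

Theorem lemma7p19 (n i : nat) (F : finFieldType) (alpha : posroot n)
    (hn : (4 <= n)%N) (hi : (1 < i <= n)%N)
    (halpha : rvec alpha = (evec n 1 + evec n i)%R) :
  (* (a) *)
  [/\ P F (lset n i :|: kset alpha) <| Salpha n F i,
      P F (kset alpha) <| Salpha n F i,
      ((P F (lset n i) * P F (kset alpha)) / P F (kset alpha))
        <| Sbar F i alpha,
      P F (alpha |: (lset n i :|: kset alpha)) <| Salpha n F i
    & (Salpha n F i / P F (lset n i :|: kset alpha)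
         \isog Sbar F i alpha /
               ((P F (lset n i) * P F (kset alpha)) / P F (kset alpha)))
      /\ (Sbar F i alpha /
            ((P F (lset n i) * P F (kset alpha)) / P F (kset alpha))
         \isog setX (Tbar F i alpha) (Xroot F alpha))]
  (* (b) *)
  /\ [/\ P F (dset n i :&: kset alpha) <| P F (dset n i),
         P F (obset n i :&: kset alpha) <| P F (obset n i)
       & exists act : groupAction
                        (P F (dset n i) / P F (dset n i :&: kset alpha))
                        (P F (obset n i) / P F (obset n i :&: kset alpha)),
           (forall x y, x \in P F (obset n i) -> y \in P F (dset n i) ->
              act (coset (P F (obset n i :&: kset alpha)) x)
                  (coset (P F (dset n i :&: kset alpha)) y)
              = coset (P F (obset n i :&: kset alpha)) (x ^ y))
           /\ Tbar F i alpha \isog [set: sdprod_by act]]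
  (* (c) *)
  /\ ((i < n)%N ->
      [/\ pattern (kobset n i), pnormal (kobset n i) (dset n i)
        & P F (kobset n i)
            \subset 'C(P F (obset n i) / P F (obset n i :&: kset alpha) | 'Q)])
  (* (d) *)
  /\ (i = n -> P F (obset n i) / P F (obset n i :&: kset alpha) = 1)
  (* (e) *)
  /\ ((i = 2 \/ i = 3) -> i = n -> Tbar F i alpha = 1)
  (* (f) *)
  /\ ((i = 2 \/ i = 3) -> (i < n)%N ->
      [/\ kobset n i = dset n i, kset alpha = nset alpha
        & Tbar F i alpha
            \isog setX (UD (n - 2)%N F) (setXn (fun _ : 'I_(i - 1)%N => UA 1%N F))])
  (* (g) *)
  /\ ((3 < i)%N ->
      exists N : {set posroot (n - 2)%N},
        pnormal N setT
        /\ (P F (dset n i) / P F (dset n i :&: kset alpha)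
              \isog UD (n - 2)%N F / P F N))
  (* (h) *)
  /\ ((3 < i)%N ->
      P F (kobset n i :|: (kset alpha :&: dset n i)) <| P F (dset n i)
      /\ (P F (dset n i) / P F (kobset n i :|: (kset alpha :&: dset n i))
            \isog UA (i - 3)%N F)).
Proof.
have [ri_alpha rj_alpha plus_alpha] := e1ei_coords hi halpha.
have isoT := Tbar_isog_dset_obset F hi ri_alpha rj_alpha plus_alpha.
rewrite /Tbar /Sbar /Salpha (kset_alpha hi ri_alpha rj_alpha plus_alpha).
split; [exact: Salpha_quotients | split; [|split; [|split; [|split; [|split;
  [|split]]]]]].
- have [nD nO [act [actE iso]]] := dset_obset_sdprod_isog F hi.
  by split=> //; exists act; split=> //; apply: isog_trans isoT iso.
- move=> ltin; have nK := kobset_normal hi ltin.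
  by split; [exact: pattern_normal nK | exact: nK | exact: kobset_centralizes].
- exact: obset_quotient1.
(* The conditions i <= 3 and i = n of (e) contradict n >= 4. *)
- by case=> ->; lia.
- move=> i23 ltin; have i3 : (i <= 3)%N by lia.
  split; first exact: kobset_dset.
    rewrite -(kset_alpha hi ri_alpha rj_alpha plus_alpha).
    exact: (kset_alpha_nset hi ri_alpha rj_alpha plus_alpha).
  exact: isog_trans isoT (dset_obset_setX_isog hn hi i3 ltin (obset_UA1_isog F
    hi)).
- move=> i3; have nD := dset_kiset_normal hi.
  (* The normal set for D_(n-2) is obtained by renumbering the coordinates other than 1 and i. *)
  exists (skip_root hn hi @^-1: (dset n i :&: kiset n i)).
  by split; [exact: skip_root_pnormal | exact: dset_quotient_UD_isog].
move=> i3; split; last exact: dset_quotient_UA_isog.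
exact: P_normal (kobset_kiset_normal hi).
Qed.
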